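(* Let $X$ be a compact $\partial\bar\partial$-manifold with $\dim_{\mathbb{C}}X=n$. (a) Every Aeppli cohomology class on $X$ (of any type $(p,q)$) contains a $d$-closed representative. (b) For any $p,q=0,1,\dots,n$, the map $$T^{p,q}:H^{p,q}_A(X,\mathbb{C})\to H^{p+q}_{DR}(X,\mathbb{C}),\qquad [\alpha]_A\mapsto\{\alpha\},$$ where $\alpha$ is any $d$-closed $(p,q)$-form representing the Aeppli class $[\alpha]_A$ (such a representative exists by (a)), is a well-defined (i.e. independent of the choice of the $d$-closed representative) canonical injective linear map. (c) For any $k=0,1,\dots,2n$, there is a canonical isomorphism $$\bigoplus_{p+q=k}H^{p,q}_A(X,\mathbb{C})\xrightarrow{\ \simeq\ }H^k_{DR}(X,\mathbb{C}),\qquad \sum_{p+q=k}[\alpha^{p,q}]_A\mapsto\Big\{\sum_{p+q=k}\alpha^{p,q}\Big\},$$ where each $\alpha^{p,q}$ is a $d$-closed representative of the Aeppli class $[\alpha^{p,q}]_A$. Moreover, $H^{p,q}_A(X,\mathbb{C})=\overline{H^{q,p}_A(X,\mathbb{C})}$ for all $p,q$ (and this last identity holds on any compact complex manifold $X$, without the $\partial\bar\partial$-assumption).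
   Context: A compact complex manifold $X$ is a $\partial\bar\partial$-manifold if for all $p,q$ and every smooth $d$-closed form $u$ of pure type $(p,q)$ on $X$, the properties of $d$-exactness, $\partial$-exactness, $\bar\partial$-exactness and $\partial\bar\partial$-exactness of $u$ are equivalent. The Aeppli cohomology group of type $(p,q)$ is $$H^{p,q}_A(X,\mathbb{C})=\frac{\ker(\partial\bar\partial:C^\infty_{p,q}(X)\to C^\infty_{p+1,q+1}(X))}{\mathrm{Im}(\partial:C^\infty_{p-1,q}(X)\to C^\infty_{p,q}(X))+\mathrm{Im}(\bar\partial:C^\infty_{p,q-1}(X)\to C^\infty_{p,q}(X))},$$ with classes denoted $[\ ]_A$; $\{\ \}$ denotes a De Rham class. $\overline{H^{q,p}_A}$ denotes the image of $H^{q,p}_A$ under complex conjugation of classes, $\overline{[\alpha]_A}=[\bar\alpha]_A$. *)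

(* Defs.v *)
From HB Require Import structures.
From mathcomp Require Import all_boot all_order all_algebra complex.
From mathcomp Require Import all_classical all_reals all_analysis.

Set Implicit Arguments.
Unset Strict Implicit.
Unset Printing Implicit Defensive.

Import Order.TTheory GRing.Theory Num.Theory.
Import numFieldNormedType.Exports.

Local Open Scope classical_set_scope.
Local Open Scope complex_scope.
Local Open Scope ring_scope.

Record submodule (K : pzRingType) (V : lmodType K) := Submodule {
  submodule_set :> V -> Prop;
  submodule0 : submodule_set 0;
  submoduleP : forall (a : K) u v, submodule_set u -> submodule_set v ->
    submodule_set (a *: u + v) }.

Section SubmoduleTheory.
Context {K : pzRingType} {V : lmodType K} (B : submodule V).

Lemma submoduleD u v : B u -> B v -> B (u + v).
Proof. by move=> hu hv; rewrite -[u]scale1r; apply: submoduleP. Qed.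

Lemma submoduleZ a u : B u -> B (a *: u).
Proof. by move=> hu; rewrite -[_ *: _]addr0; apply: submoduleP => //; apply: submodule0. Qed.

Lemma submoduleN u : B u -> B (- u).
Proof. by move=> hu; rewrite -scaleN1r; apply: submoduleZ. Qed.

Lemma submoduleB u v : B u -> B v -> B (u - v).
Proof. by move=> hu hv; apply: submoduleD => //; apply: submoduleN. Qed.
End SubmoduleTheory.

Section SubmoduleConstructions.
Context {K : pzRingType} {V W : lmodType K}.

Program Definition zero_submodule := @Submodule K V (fun v => v = 0) _ _.
Next Obligation. by []. Qed.
Next Obligation. by move=> a _ _ -> ->; rewrite scaler0 addr0. Qed.

Program Definition sum_submodule (A B : submodule V) := @Submodule K V
  (fun w => exists u v, [/\ A u, B v & w = u + v]) _ _.
Next Obligation.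
by move=> A B; exists 0, 0; rewrite addr0; split => //; apply: submodule0.
Qed.
Next Obligation.
move=> A B a _ _ [u [v [hu hv ->]]] [u' [v' [hu' hv' ->]]].
exists (a *: u + u'), (a *: v + v'); split; try exact: submoduleP.
by rewrite scalerDr addrACA.
Qed.

Definition linear_on (A : submodule V) (f : V -> W) :=
  forall (a : K) u v, A u -> A v -> f (a *: u + v) = a *: f u + f v.

Lemma linear_on0 (A : submodule V) f : linear_on A f -> f 0 = 0.
Proof.
move=> fl; have := fl 1 0 0 (submodule0 A) (submodule0 A).
rewrite scaler0 addr0 scale1r -[X in X = _]addr0.
by move=> /addrI.
Qed.

Program Definition ker_submodule (A : submodule V) f (fl : linear_on A f) :=
  @Submodule K V (fun u => A u /\ f u = 0) _ _.
Next Obligation.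
by move=> A f fl; split; [apply: submodule0 | apply: linear_on0 fl].
Qed.
Next Obligation.
move=> A f fl a u v [hu fu] [hv fv]; split; first exact: submoduleP.
by rewrite fl// fu fv scaler0 addr0.
Qed.

Program Definition image_submodule (A : submodule V) f (fl : linear_on A f) :=
  @Submodule K W (f @` A) _ _.
Next Obligation.
by move=> A f fl; exists 0; [apply: submodule0 | apply: linear_on0 fl].
Qed.
Next Obligation.
move=> A f fl a _ _ [u hu <-] [v hv <-].
by exists (a *: u + v); [apply: submoduleP | rewrite fl].
Qed.
End SubmoduleConstructions.

(* The quotient Z/B of two submodules of V, as the type of the cosets
   z + B = [set v | B (v - z)] with z in Z.  It is used with B contained in Z;
   in general it is (Z + B)/B. *)
Record quotient_space (K : pzRingType) (V : lmodType K) (Z B : submodule V) :=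
  QuotientSpace {
    coset :> V -> Prop;
    cosetP : exists2 z, Z z & coset = [set v | B (v - z)] }.

Section QuotientSpace.
Context (K : pzRingType) (V : lmodType K) (Z B : submodule V).
Local Notation Q := (quotient_space Z B).

HB.instance Definition _ := gen_eqMixin Q.
HB.instance Definition _ := gen_choiceMixin Q.

Lemma coset_inj (c c' : Q) : coset c = coset c' -> c = c'.
Proof.
case: c c' => [s hs] [s' hs'] /= e; move: hs hs'; rewrite e => hs hs'.
by congr QuotientSpace; apply: Prop_irrelevance.
Qed.

Definition coset_class z (hz : Z z) : Q := QuotientSpace (ex_intro2 _ _ z hz erefl).

Definition repr_coset (c : Q) : V := s2val (cid2 (cosetP c)).

Lemma repr_cosetZ c : Z (repr_coset c).
Proof. by rewrite /repr_coset; case: cid2. Qed.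

Lemma repr_cosetE c : coset c = [set v | B (v - repr_coset c)].
Proof. by rewrite /repr_coset; case: cid2. Qed.

Lemma coset_classE z z' (hz : Z z) (hz' : Z z') :
  B (z - z') -> coset_class hz = coset_class hz'.
Proof.
move=> h; apply: coset_inj; apply/seteqP; split => v /= hv.
  have -> : v - z' = (v - z) + (z - z') by rewrite addrA subrK.
  exact: submoduleD.
have -> : v - z = (v - z') - (z - z') by rewrite opprB addrA subrK.
exact: submoduleB.
Qed.

Lemma repr_coset_class z (hz : Z z) : B (repr_coset (coset_class hz) - z).
Proof.
have : coset (coset_class hz) (repr_coset (coset_class hz)).
  by rewrite repr_cosetE /= subrr; apply: submodule0.
by [].
Qed.

Lemma repr_cosetK c : coset_class (repr_cosetZ c) = c.
Proof. by apply: coset_inj; rewrite /= -repr_cosetE. Qed.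

Definition coset_zero : Q := coset_class (submodule0 Z).
Definition coset_add (c c' : Q) : Q :=
  coset_class (submoduleD (repr_cosetZ c) (repr_cosetZ c')).
Definition coset_opp (c : Q) : Q := coset_class (submoduleN (repr_cosetZ c)).
Definition coset_scale (a : K) (c : Q) : Q :=
  coset_class (submoduleZ a (repr_cosetZ c)).

Lemma coset_addE u v (hu : Z u) (hv : Z v) (huv : Z (u + v)) :
  coset_add (coset_class hu) (coset_class hv) = coset_class huv.
Proof.
apply: coset_classE; rewrite opprD addrACA.
by apply: submoduleD; apply: repr_coset_class.
Qed.

Lemma coset_scaleE a u (hu : Z u) (hau : Z (a *: u)) :
  coset_scale a (coset_class hu) = coset_class hau.
Proof.
by apply: coset_classE; rewrite -scalerBr; apply/submoduleZ/repr_coset_class.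
Qed.

Lemma coset_oppE u (hu : Z u) (hNu : Z (- u)) :
  coset_opp (coset_class hu) = coset_class hNu.
Proof.
by apply: coset_classE; rewrite -opprD; apply/submoduleN/repr_coset_class.
Qed.

Lemma coset_class_eq z z' (hz : Z z) (hz' : Z z') :
  z = z' -> coset_class hz = coset_class hz'.
Proof. by move=> e; apply: coset_classE; rewrite e subrr; apply: submodule0. Qed.

Lemma cosetW (P : Q -> Prop) : (forall z (hz : Z z), P (coset_class hz)) ->
  forall c, P c.
Proof. by move=> h c; rewrite -(repr_cosetK c). Qed.

Lemma coset_addA : associative coset_add.
Proof.
elim/cosetW => x hx; elim/cosetW => y hy; elim/cosetW => z hz.
have hxy := submoduleD hx hy; have hyz := submoduleD hy hz.
rewrite (coset_addE hx hy hxy) (coset_addE hy hz hyz).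
rewrite (coset_addE hx hyz (submoduleD hx hyz)).
rewrite (coset_addE hxy hz (submoduleD hxy hz)).
by apply: coset_class_eq; rewrite addrA.
Qed.

Lemma coset_addC : commutative coset_add.
Proof.
elim/cosetW => x hx; elim/cosetW => y hy.
rewrite (coset_addE hx hy (submoduleD hx hy)).
rewrite (coset_addE hy hx (submoduleD hy hx)).
by apply: coset_class_eq; rewrite addrC.
Qed.

Lemma coset_add0 : left_id coset_zero coset_add.
Proof.
elim/cosetW => x hx.
rewrite (coset_addE (submodule0 Z) hx (submoduleD (submodule0 Z) hx)).
by apply: coset_class_eq; rewrite add0r.
Qed.

Lemma coset_addN :
  left_inverse coset_zero coset_opp coset_add.
Proof.
elim/cosetW => x hx; have hN := submoduleN hx.
rewrite (coset_oppE hx hN) (coset_addE hN hx (submoduleD hN hx)).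
by apply: coset_class_eq; rewrite addNr.
Qed.

HB.instance Definition _ :=
  GRing.isZmodule.Build Q coset_addA coset_addC coset_add0 coset_addN.

Lemma coset_scaleA a b (c : Q) :
  coset_scale a (coset_scale b c) = coset_scale (a * b) c.
Proof.
elim/cosetW: c => x hx; have hb := submoduleZ b hx.
rewrite (coset_scaleE hx hb) (coset_scaleE hb (submoduleZ a hb)).
rewrite (coset_scaleE hx (submoduleZ (a * b) hx)).
by apply: coset_class_eq; rewrite scalerA.
Qed.

Lemma coset_scale1 : left_id 1 coset_scale.
Proof.
elim/cosetW => x hx; rewrite (coset_scaleE hx (submoduleZ 1 hx)).
by apply: coset_class_eq; rewrite scale1r.
Qed.

Lemma coset_scaleDr :
  right_distributive coset_scale (fun c c' : Q => c + c').
Proof.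
move=> a; elim/cosetW => x hx; elim/cosetW => y hy.
have hxy := submoduleD hx hy; have hax := submoduleZ a hx.
have hay := submoduleZ a hy.
have -> : coset_class hx + coset_class hy = coset_class hxy.
  exact: coset_addE.
rewrite (coset_scaleE hxy (submoduleZ a hxy)) (coset_scaleE hx hax).
rewrite (coset_scaleE hy hay).
rewrite [RHS](coset_addE hax hay (submoduleD hax hay)).
by apply: coset_class_eq; rewrite scalerDr.
Qed.

Lemma coset_scaleDl (c : Q) :
  {morph coset_scale^~ c : a b / a + b >-> a + b}.
Proof.
move=> a b; elim/cosetW: c => x hx.
have hax := submoduleZ a hx; have hbx := submoduleZ b hx.
rewrite (coset_scaleE hx (submoduleZ (a + b) hx)) (coset_scaleE hx hax).
rewrite (coset_scaleE hx hbx) [RHS](coset_addE hax hbx (submoduleD hax hbx)).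
by apply: coset_class_eq; rewrite scalerDl.
Qed.

HB.instance Definition _ := GRing.Zmodule_isLmodule.Build K Q
  coset_scaleA coset_scale1 coset_scaleDr coset_scaleDl.
End QuotientSpace.

(* The library has no module structure on dependent families; over a finite
   index type this is the direct sum. *)
Definition direct_sum (K : pzRingType) (I : finType) (V : I -> lmodType K) :=
  forall i, V i.

Section DirectSum.
Context (K : pzRingType) (I : finType) (V : I -> lmodType K).
Local Notation S := (direct_sum V).

Lemma direct_sumP (s t : S) : (forall i, s i = t i) -> s = t.
Proof. exact: functional_extensionality_dep. Qed.

HB.instance Definition _ := gen_eqMixin S.
HB.instance Definition _ := gen_choiceMixin S.

Program Definition direct_sum_zmod := @GRing.isZmodule.Build S
  (fun i => 0) (fun s i => - s i) (fun s t i => s i + t i) _ _ _ _.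
Next Obligation. by move=> s t u; refine (direct_sumP _) => i; rewrite addrA. Qed.
Next Obligation. by move=> s t; refine (direct_sumP _) => i; rewrite addrC. Qed.
Next Obligation. by move=> s; refine (direct_sumP _) => i; rewrite add0r. Qed.
Next Obligation. by move=> s; refine (direct_sumP _) => i; rewrite addNr. Qed.
HB.instance Definition _ := direct_sum_zmod.

Program Definition direct_sum_lmod := @GRing.Zmodule_isLmodule.Build K S
  (fun a s i => a *: s i) _ _ _ _.
Next Obligation. by move=> a b s; refine (direct_sumP _) => i; rewrite scalerA. Qed.
Next Obligation. by move=> s; refine (direct_sumP _) => i; rewrite scale1r. Qed.
Next Obligation. by move=> a s t; refine (direct_sumP _) => i; rewrite scalerDr. Qed.
Next Obligation. by move=> s a b; refine (direct_sumP _) => i; rewrite scalerDl. Qed.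
HB.instance Definition _ := direct_sum_lmod.
End DirectSum.

(* The exterior algebra on generators e_0, ..., e_(m-1): [u S] is the coefficient
   of e_S = e_(s_1) /\ ... /\ e_(s_k), where S = {s_1 < ... < s_k}. *)
Notation ext_alg K m := {ffun {set 'I_m} -> K^o}.

Section ExteriorAlgebra.
Context (K : comPzRingType) (m : nat).
Implicit Types u v : ext_alg K m.

Definition ext_basis (S : {set 'I_m}) : ext_alg K m :=
  [ffun T => (T == S)%:R].

Definition ext_gen (s : 'I_m) : ext_alg K m := ext_basis [set s]%SET.

(* The sign of the shuffle sorting the elements of A followed by those of B. *)
Definition shuffle_sign (A B : {set 'I_m}) : K :=
  (-1) ^+ #|[set x : 'I_m * 'I_m | [&& x.1 \in A, x.2 \in B & (x.2 < x.1)%N]]%SET|.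

Definition wedge u v : ext_alg K m :=
  [ffun S : {set 'I_m} => \sum_(A : {set 'I_m} | A \subset S)
     shuffle_sign A (S :\: A)%SET * u A * v (S :\: A)%SET].

(* The linear map sending e_(s_1) /\ ... /\ e_(s_k), s_1 < ... < s_k, to
   t(s_1) /\ ... /\ t(s_k); [enum S] lists S in increasing order. *)
Definition ext_subst (t : 'I_m -> ext_alg K m) u : ext_alg K m :=
  \sum_(S : {set 'I_m})
    u S *: \big[wedge/ext_basis finset.set0]_(s <- enum S) t s.

Lemma wedgeP a u u' v : wedge (a *: u + u') v = a *: wedge u v + wedge u' v.
Proof.
apply/ffunP => S; rewrite !ffunE scaler_sumr -big_split /=.
apply: eq_bigr => A _; rewrite !ffunE mulrDr mulrDl; congr (_ + _).
by rewrite /GRing.scale /= !mulrA [a * _]mulrC.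
Qed.

Lemma ext_substP t a u v :
  ext_subst t (a *: u + v) = a *: ext_subst t u + ext_subst t v.
Proof.
rewrite /ext_subst scaler_sumr -big_split /=; apply: eq_bigr => S _.
by rewrite !ffunE scalerDl scalerA.
Qed.
End ExteriorAlgebra.

(* C^n is identified with R^(2n), the coordinates of index [lshift n a] and
   [rshift n a] being x_a and y_a, with z_a = x_a + i y_a. *)

Section LocalForms.
Context (R : realType) (n : nat).
Local Notation C := (R[i]).
Local Notation V := ('rV[R]_(n + n)).

(* Complex forms at a point: the generator of index [lshift n a] is dz_a and
   that of index [rshift n a] is d\bar z_a. *)
Local Notation L := (ext_alg C (n + n)).

Definition pderiv (s : 'I_(n + n)) (f : V -> R) (z : V) : R :=
  'D_(delta_mx 0 s) f z.

Fixpoint class_C (k : nat) (W : set V) (f : V -> R) : Prop :=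
  (forall z, W z -> {for z, continuous f}) /\
  if k is k'.+1 then
    forall s, (forall z, W z -> derivable f z (delta_mx 0 s)) /\
              class_C k' W (pderiv s f)
  else True.

Definition smooth (W : set V) (f : V -> C) : Prop :=
  forall k, class_C k W (fun z => complex.Re (f z)) /\
            class_C k W (fun z => complex.Im (f z)).

Definition cpderiv (s : 'I_(n + n)) (f : V -> C) (z : V) : C :=
  pderiv s (fun w => complex.Re (f w)) z +i* pderiv s (fun w => complex.Im (f w)) z.

Definition wirtinger (a : 'I_n) (f : V -> C) (z : V) : C :=
  2^-1 * (cpderiv (lshift n a) f z - 'i%C * cpderiv (rshift n a) f z).
Definition wirtinger_bar (a : 'I_n) (f : V -> C) (z : V) : C :=
  2^-1 * (cpderiv (lshift n a) f z + 'i%C * cpderiv (rshift n a) f z).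

Definition differential (f : V -> C) (z : V) : L :=
  \sum_(a < n) (wirtinger a f z *: ext_gen C (lshift n a)
              + wirtinger_bar a f z *: ext_gen C (rshift n a)).

(* d (sum_S w_S e_S) = sum_S d w_S /\ e_S *)
Definition local_d (w : V -> L) (z : V) : L :=
  \sum_(S : {set 'I_(n + n)})
    wedge (differential (fun y => w y S) z) (ext_basis C S).

Definition zcoord (a : 'I_n) (z : V) : C :=
  z 0 (lshift n a) +i* z 0 (rshift n a).

Definition pullback (f : V -> V) (w : V -> L) (z : V) : L :=
  ext_subst (fun s => match fintype.split s with
    | inl a => differential (fun y => zcoord a (f y)) z
    | inr a => differential (fun y => (zcoord a (f y))^*%C) z
    end) (w (f z)).

(* Smoothness is built in: the Cauchy-Riemann equations alone do not make sense
   of [wirtinger_bar] at points where f is not differentiable. *)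
Definition holomorphic (W : set V) (f : V -> V) : Prop :=
  forall a : 'I_n, smooth W (fun z => zcoord a (f z)) /\
    forall b z, W z -> wirtinger_bar b (fun y => zcoord a (f y)) z = 0.

(* The bidegree of e_S. *)
Definition bidegree (S : {set 'I_(n + n)}) : nat * nat :=
  (#|[set a : 'I_n | lshift n a \in S]%SET|,
   #|[set a : 'I_n | rshift n a \in S]%SET|).

Definition component (p q : nat) (u : L) : L :=
  [ffun S : {set 'I_(n + n)} => if bidegree S == (p, q) then u S else 0].

(* Complex conjugation: antilinear, multiplicative, exchanging dz_a and
   d\bar z_a. *)
Definition conj_ext (u : L) : L :=
  ext_subst (fun s => ext_gen C (match fintype.split s with
    | inl a => rshift n a
    | inr a => lshift n a
    end)) [ffun S : {set 'I_(n + n)} => (u S)^*%C].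

Lemma class_C_ext k W f g : open W -> (forall z, W z -> f z = g z) ->
  class_C k W f -> class_C k W g.
Proof.
move=> oW.
have near_W (h h' : V -> R) : (forall z, W z -> h z = h' z) ->
    forall z, W z -> \forall y \near z, h y = h' y :> R.
  move=> e z Wz; have : nbhs z W by exact: open_nbhs_nbhs.
  by apply: filterS => y; exact: e.
have cont (h h' : V -> R) : (forall z, W z -> h z = h' z) ->
    (forall z, W z -> {for z, continuous h}) ->
    forall z, W z -> {for z, continuous h'}.
  move=> e hc z Wz; rewrite /prop_for /continuous_at -(e _ Wz).
  apply: cvg_trans (hc _ Wz); apply: near_eq_cvg.
    exact: (nbhs_filter z).
  exact: near_W e _ Wz.
elim: k f g => [|k IH] f g e /= [fc fd]; split => //; try exact: cont fc.
move=> s; have [fs fk] := fd s; split.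
  by move=> z Wz; apply: near_eq_derivable (fs _ Wz); apply: near_W Wz.
apply: IH fk => z Wz; rewrite /pderiv; apply: near_eq_derive.
exact: near_W Wz.
Qed.

Lemma pderiv_lin s (a b : R) (f g : V -> R) z :
  derivable f z (delta_mx 0 s) -> derivable g z (delta_mx 0 s) ->
  pderiv s (fun y => a * f y + b * g y) z = a * pderiv s f z + b * pderiv s g z.
Proof.
move=> df dg; rewrite /pderiv.
rewrite [LHS](@deriveD _ _ _ (a \*: f) (b \*: g)); try exact: derivableZ.
by rewrite !deriveZ.
Qed.

Lemma class_C_lin k W (a b : R) f g : open W -> class_C k W f ->
  class_C k W g -> class_C k W (fun z => a * f z + b * g z).
Proof.
move=> oW; elim: k f g => [|k IH] f g /= [fc fd] [gc gd]; split => //.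
- move=> z Wz.
  exact: (cvgD (cvgM (cvg_cst a) (fc z Wz)) (cvgM (cvg_cst b) (gc z Wz))).
- move=> z Wz.
  exact: (cvgD (cvgM (cvg_cst a) (fc z Wz)) (cvgM (cvg_cst b) (gc z Wz))).
move=> s; have [fs fk] := fd s; have [gs gk] := gd s; split.
  move=> z Wz; apply: (@derivableD _ _ _ (a \*: f) (b \*: g)); apply: derivableZ.
    exact: fs.
  exact: gs.
apply: class_C_ext (IH _ _ fk gk) => // z Wz.
by rewrite pderiv_lin//; [apply: fs | apply: gs].
Qed.

Lemma smooth_lin W (c : C) f g : open W -> smooth W f -> smooth W g ->
  smooth W (fun z => c * f z + g z).
Proof.
move=> oW hf hg k; have [f1 f2] := hf k; have [g1 g2] := hg k.
have := class_C_lin 1 1 oW (class_C_lin (complex.Re c) (- complex.Im c) oW f1 f2) g1.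
have := class_C_lin 1 1 oW (class_C_lin (complex.Re c) (complex.Im c) oW f2 f1) g2.
move=> h2 h1; split; [apply: class_C_ext h1 | apply: class_C_ext h2] => // z _.
  by rewrite !mul1r; move: {h2} c => c; case: c (f z) (g z) => [a b] [x y] [x' y'] /=; rewrite mulNr.
by rewrite !mul1r; move: {h1} c => c; case: c (f z) (g z) => [a b] [x y] [x' y'] /=.
Qed.

Lemma smooth0 W : open W -> smooth W (fun _ => 0).
Proof.
move=> oW k.
have h : class_C k W (fun=> 0).
  have cc z : W z -> {for z, continuous (fun=> 0 : R)}.
    by move=> _; exact: cst_continuous.
  elim: k => [|k IH]; split => //.
  move=> s; split; first by move=> z _; apply: derivable_cst.
  by apply: class_C_ext IH => // z _; rewrite /pderiv derive_cst.
by split.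
Qed.

Lemma smooth_ext W f g : open W -> (forall z, W z -> f z = g z) ->
  smooth W f -> smooth W g.
Proof.
by move=> oW e hf k; have [f1 f2] := hf k; split;
  [apply: class_C_ext f1 | apply: class_C_ext f2] => // z Wz; rewrite e.
Qed.

Lemma smoothZ W (c : C) f : open W -> smooth W f -> smooth W (fun z => c * f z).
Proof.
move=> oW hf; apply: smooth_ext (smooth_lin c oW hf (smooth0 oW)) => // z _.
by rewrite addr0.
Qed.

Lemma smoothD W f g : open W -> smooth W f -> smooth W g ->
  smooth W (fun z => f z + g z).
Proof.
move=> oW hf hg; apply: smooth_ext (smooth_lin 1 oW hf hg) => // z _.
by rewrite mul1r.
Qed.

Lemma smooth_sum W (I : Type) (r : seq I) (P : pred I) (F : I -> V -> C) :
  open W -> (forall i, smooth W (F i)) ->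
  smooth W (fun z => \sum_(i <- r | P i) F i z).
Proof.
move=> oW hF; elim: r => [|i r IH].
  by apply: smooth_ext (smooth0 oW) => // z _; rewrite big_nil.
case Pi : (P i); last by apply: smooth_ext IH => // z _; rewrite big_cons Pi.
by apply: smooth_ext (smoothD oW (hF i) IH) => // z _; rewrite big_cons Pi.
Qed.

Lemma smooth_cpderiv s W f : open W -> smooth W f -> smooth W (cpderiv s f).
Proof.
by move=> oW hf k; have [[_ f1] [_ f2]] := hf k.+1; split; [apply: (f1 s).2 | apply: (f2 s).2].
Qed.

Lemma smooth_wirtinger a W f : open W -> smooth W f -> smooth W (wirtinger a f).
Proof.
move=> oW hf; apply: smoothZ => //; apply: smoothD (smooth_cpderiv _ oW hf) _ => //.
apply: smooth_ext (smoothZ (- 'i%C) oW (smooth_cpderiv (rshift n a) oW hf)) => // z _.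
by rewrite mulNr.
Qed.

Lemma smooth_wirtinger_bar a W f :
  open W -> smooth W f -> smooth W (wirtinger_bar a f).
Proof.
move=> oW hf; apply: smoothZ => //; apply: smoothD (smooth_cpderiv _ oW hf) _ => //.
exact: smoothZ (smooth_cpderiv _ oW hf).
Qed.

Lemma smooth_differential W f S : open W -> smooth W f ->
  smooth W (fun z => differential f z S).
Proof.
move=> oW hf; pose F (a : 'I_n) z :=
  ext_gen C (lshift n a) S * wirtinger a f z
  + ext_gen C (rshift n a) S * wirtinger_bar a f z.
apply: (@smooth_ext _ (fun z => \sum_(a < n) F a z)) => //.
  move=> z _; rewrite /differential sum_ffunE; apply: eq_bigr => a _.
  by rewrite /F [RHS]ffunE; congr (_ + _); rewrite [RHS]ffunE; exact: mulrC.
apply: smooth_sum => // a; apply: smoothD => //; apply: smoothZ => //.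
  exact: smooth_wirtinger.
exact: smooth_wirtinger_bar.
Qed.

Lemma smooth_local_d W (w : V -> L) T : open W ->
  (forall S, smooth W (fun z => w z S)) -> smooth W (fun z => local_d w z T).
Proof.
move=> oW hw; pose F (S A : {set 'I_(n + n)}) z : C :=
  shuffle_sign C A (T :\: A)%SET * ext_basis C S (T :\: A)%SET
  * differential (fun y => w y S) z A.
apply: (@smooth_ext _ (fun z => \sum_(S : {set 'I_(n + n)})
  \sum_(A : {set 'I_(n + n)} | A \subset T) F S A z)) => //.
  move=> z _; rewrite /local_d sum_ffunE; apply: eq_bigr => S _.
  by rewrite [in RHS]ffunE; apply: eq_bigr => A _; rewrite /F mulrAC.
apply: smooth_sum => // S; apply: smooth_sum => // A; apply: smoothZ => //.
exact: smooth_differential.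
Qed.

Lemma cpderiv_lin s W (c : C) f g z : W z -> smooth W f -> smooth W g ->
  cpderiv s (fun y => c * f y + g y) z = c * cpderiv s f z + cpderiv s g z.
Proof.
move=> Wz hf hg.
have [/= [_ f1] [_ f2]] := hf 1%N; have [/= [_ g1] [_ g2]] := hg 1%N.
have {}f1 := (f1 s).1 _ Wz; have {}f2 := (f2 s).1 _ Wz.
have {}g1 := (g1 s).1 _ Wz; have {}g2 := (g2 s).1 _ Wz.
rewrite /cpderiv; case: c => a b.
have comb (x y : R) (F G : V -> R) : derivable F z (delta_mx 0 s) ->
    derivable G z (delta_mx 0 s) ->
    derivable (fun y' => x * F y' + y * G y') z (delta_mx 0 s).
  by move=> dF dG; apply: (@derivableD _ _ _ (x \*: F) (y \*: G)); apply: derivableZ.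
apply/eqP; rewrite eq_complex /=; apply/andP; split; apply/eqP.
  have -> : (fun y => complex.Re ((a +i* b) * f y + g y)) =
      (fun y => 1 * (a * complex.Re (f y) + - b * complex.Im (f y))
                + 1 * complex.Re (g y)).
    apply: funext => y; rewrite !mul1r.
    by case: (f y) (g y) => [? ?] [? ?] /=; rewrite mulNr.
  rewrite (pderiv_lin 1 1 (comb a (- b) _ _ f1 f2) g1) (pderiv_lin a (- b) f1 f2).
  by rewrite 2!mul1r mulNr.
have -> : (fun y => complex.Im ((a +i* b) * f y + g y)) =
    (fun y => 1 * (a * complex.Im (f y) + b * complex.Re (f y))
              + 1 * complex.Im (g y)).
  by apply: funext => y; rewrite !mul1r; case: (f y) (g y) => [? ?] [? ?].
rewrite (pderiv_lin 1 1 (comb a b _ _ f2 f1) g2) (pderiv_lin a b f2 f1).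
by rewrite 2!mul1r.
Qed.

Lemma wirtinger_lin a W (c : C) f g z : W z -> smooth W f -> smooth W g ->
  wirtinger a (fun y => c * f y + g y) z = c * wirtinger a f z + wirtinger a g z.
Proof.
move=> Wz hf hg; rewrite /wirtinger !(cpderiv_lin _ c Wz hf hg).
rewrite ['i%C * (_ + _)]mulrDr opprD addrACA [LHS]mulrDr; congr (_ + _).
by rewrite ['i%C * _]mulrCA -mulrBr mulrCA.
Qed.

Lemma wirtinger_bar_lin a W (c : C) f g z : W z -> smooth W f -> smooth W g ->
  wirtinger_bar a (fun y => c * f y + g y) z
  = c * wirtinger_bar a f z + wirtinger_bar a g z.
Proof.
move=> Wz hf hg; rewrite /wirtinger_bar !(cpderiv_lin _ c Wz hf hg).
rewrite ['i%C * (_ + _)]mulrDr addrACA [LHS]mulrDr; congr (_ + _).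
by rewrite ['i%C * _]mulrCA -mulrDr mulrCA.
Qed.

Lemma differential_lin W (c : C) f g z : W z -> smooth W f -> smooth W g ->
  differential (fun y => c * f y + g y) z
  = c *: differential f z + differential g z.
Proof.
move=> Wz hf hg; rewrite /differential scaler_sumr -big_split /=.
apply: eq_bigr => a _; rewrite scalerDr !scalerA addrACA -!scalerDl.
by rewrite (wirtinger_lin a c Wz hf hg) (wirtinger_bar_lin a c Wz hf hg).
Qed.

Lemma local_d_lin W (c : C) (u v : V -> L) z : W z ->
  (forall S, smooth W (fun z => u z S)) -> (forall S, smooth W (fun z => v z S)) ->
  local_d (c *: u + v) z = c *: local_d u z + local_d v z.
Proof.
move=> Wz hu hv; rewrite /local_d scaler_sumr -big_split /=.
apply: eq_bigr => S _; rewrite -wedgeP.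
have -> : (fun y => (c *: u + v) y S) = (fun y => c * u y S + v y S).
  by apply: funext => y; rewrite !fctE !ffunE.
by rewrite (differential_lin c Wz (hu S) (hv S)).
Qed.

Lemma componentP p q (c : C) u v :
  component p q (c *: u + v) = c *: component p q u + component p q v.
Proof.
by apply/ffunP => S; rewrite !ffunE; case: ifP => _; rewrite ?scaler0 ?addr0.
Qed.

Lemma pullback_lin f (c : C) (u v : V -> L) z :
  pullback f (c *: u + v) z = c *: pullback f u z + pullback f v z.
Proof. by rewrite /pullback -ext_substP. Qed.

End LocalForms.

(* A Hausdorff space with a holomorphic atlas modelled on C^n.  Connectedness is
   not required, and second countability is automatic in the compact case.  The
   local inverses [param] are total functions whose values outside the images of
   the charts are irrelevant. *)
Record complex_manifold (R : realType) (n : nat) := ComplexManifold {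
  points :> topologicalType;
  points_hausdorff : hausdorff_space points;
  atlas : Type;
  domain : atlas -> set points;
  chart : atlas -> points -> 'rV[R]_(n + n);
  param : atlas -> 'rV[R]_(n + n) -> points;
  domain_open : forall i, open (domain i);
  domain_cover : forall x, exists i, domain i x;
  chart_open : forall i, open (chart i @` domain i);
  chartK : forall i x, domain i x -> param i (chart i x) = x;
  chart_continuous : forall i x, domain i x -> {for x, continuous (chart i)};
  param_continuous : forall i z, (chart i @` domain i) z ->
    {for z, continuous (param i)};
  transition_holomorphic : forall i j,
    holomorphic (chart i @` (domain i `&` domain j)) (chart j \o param i) }.

Section GlobalForms.
Context (R : realType) (n : nat) (X : complex_manifold R n).
Local Notation C := (R[i]).
Local Notation V := ('rV[R]_(n + n)).
Local Notation L := (ext_alg C (n + n)).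

(* Families of local expressions, one for each chart. *)
Definition local_forms := atlas X -> V -> L.
HB.instance Definition _ := GRing.Lmodule.on local_forms.

Definition chart_image (i : atlas X) : set V := chart i @` domain i.

(* A smooth complex form (of mixed degree) on X is given by its expressions in
   the charts, which are smooth and match under the transition maps; they are
   extended by 0 outside the images of the charts, so that two forms are equal
   if and only if the families are. *)
Definition smooth_form (w : local_forms) : Prop :=
  [/\ forall i z, ~ chart_image i z -> w i z = 0,
      forall i S, smooth (chart_image i) (fun z => w i z S) &
      forall i j x, domain i x -> domain j x ->
        w i (chart i x) = pullback (chart j \o param i) (w j) (chart i x)].

Lemma smooth_form_lin (a : C) u v :
  smooth_form u -> smooth_form v -> smooth_form (a *: u + v).
Proof.
move=> [u0 us uc] [v0 vs vc]; split.
- by move=> i z iz; rewrite !fctE u0// v0// scaler0 addr0.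
- move=> i S; have oi : open (chart_image i) := @chart_open _ _ X i.
  have e z : chart_image i z ->
      a * (u i z S : C) + (v i z S : C) = (a *: u + v) i z S.
    by move=> _; rewrite !fctE !ffunE.
  exact: (smooth_ext oi e (smooth_lin a oi (us i S) (vs i S))).
- move=> i j x ix jx.
  have -> : (a *: u + v) i (chart i x) = a *: u i (chart i x) + v i (chart i x).
    by [].
  by rewrite (uc i j x ix jx) (vc i j x ix jx) -pullback_lin.
Qed.

Lemma smooth_form0 : smooth_form 0.
Proof.
split=> [//|i S|i j x ix jx].
  have oi : open (chart_image i) := @chart_open _ _ X i.
  have e z : chart_image i z -> 0 = (0 : local_forms) i z S :> C.
    by move=> _; rewrite ffunE.
  exact: (smooth_ext oi e (smooth0 oi)).
by rewrite /pullback /ext_subst big1// => S _; rewrite ffunE scale0r.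
Qed.

Program Definition kforms (k : nat) := @Submodule C local_forms
  (fun w => smooth_form w /\
     forall i z (S : {set 'I_(n + n)}), #|S| != k -> w i z S = 0) _ _.
Next Obligation.
by move=> k; split=> [|i z S _]; [exact: smooth_form0 | rewrite ffunE].
Qed.
Next Obligation.
move=> k a u v [us uk] [vs vk]; split; first exact: smooth_form_lin.
by move=> i z S Sk; rewrite !fctE !ffunE uk// vk// scaler0 addr0.
Qed.

Program Definition pqforms (p q : nat) := @Submodule C local_forms
  (fun w => smooth_form w /\
     forall i z (S : {set 'I_(n + n)}), bidegree S != (p, q) -> w i z S = 0) _ _.
Next Obligation.
by move=> p q; split=> [|i z S _]; [exact: smooth_form0 | rewrite ffunE].
Qed.
Next Obligation.
move=> p q a u v [us uk] [vs vk]; split; first exact: smooth_form_lin.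
by move=> i z S Sk; rewrite !fctE !ffunE uk// vk// scaler0 addr0.
Qed.

Definition dform (w : local_forms) : local_forms :=
  fun i z => if z \in chart_image i then local_d (w i) z else 0.

(* On forms of type (p, q), the components of type (p + 1, q) and (p, q + 1)
   of d. *)
Definition del (p q : nat) (w : local_forms) : local_forms :=
  fun i z => component p.+1 q (dform w i z).
Definition delbar (p q : nat) (w : local_forms) : local_forms :=
  fun i z => component p q.+1 (dform w i z).

Definition deldelbar (p q : nat) (w : local_forms) : local_forms :=
  del p q.+1 (delbar p q w).

Definition conj_form (w : local_forms) : local_forms :=
  fun i z => conj_ext (w i z).

Lemma dform_lin (a : C) (u v : local_forms) :
  (forall i S, smooth (chart_image i) (fun z => u i z S)) ->
  (forall i S, smooth (chart_image i) (fun z => v i z S)) ->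
  dform (a *: u + v) = a *: dform u + dform v.
Proof.
move=> us vs; apply: funext => i; apply: funext => z; rewrite !fctE /dform.
have [iz|iz] := pselect (chart_image i z).
  by rewrite mem_set// (local_d_lin a iz (us i) (vs i)).
by rewrite memNset// scaler0 addr0.
Qed.

Lemma del_lin p q (a : C) (u v : local_forms) :
  (forall i S, smooth (chart_image i) (fun z => u i z S)) ->
  (forall i S, smooth (chart_image i) (fun z => v i z S)) ->
  del p q (a *: u + v) = a *: del p q u + del p q v.
Proof.
move=> us vs; apply: funext => i; apply: funext => z.
by rewrite /del dform_lin// !fctE componentP.
Qed.

Lemma delbar_lin p q (a : C) (u v : local_forms) :
  (forall i S, smooth (chart_image i) (fun z => u i z S)) ->
  (forall i S, smooth (chart_image i) (fun z => v i z S)) ->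
  delbar p q (a *: u + v) = a *: delbar p q u + delbar p q v.
Proof.
move=> us vs; apply: funext => i; apply: funext => z.
by rewrite /delbar dform_lin// !fctE componentP.
Qed.

Lemma delbar_smooth p q (u : local_forms) :
  (forall i S, smooth (chart_image i) (fun z => u i z S)) ->
  forall i S, smooth (chart_image i) (fun z => delbar p q u i z S).
Proof.
move=> us i S; have oi : open (chart_image i) by exact: (@chart_open _ _ X i).
have [pq|pq] := eqVneq (bidegree S) (p, q.+1).
  have e z : chart_image i z -> local_d (u i) z S = delbar p q u i z S :> C.
    by move=> iz; rewrite /delbar /dform ffunE pq eqxx mem_set.
  exact: (smooth_ext oi e (smooth_local_d S oi (us i))).
have e z : chart_image i z -> 0 = delbar p q u i z S :> C.
  by move=> iz; rewrite ffunE (negPf pq).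
exact: (smooth_ext oi e (smooth0 oi)).
Qed.

Lemma d_linear k : linear_on (kforms k) dform.
Proof. by move=> a u v [[_ us _] _] [[_ vs _] _]; apply: dform_lin. Qed.

Lemma del_linear p q : linear_on (pqforms p q) (del p q).
Proof. by move=> a u v [[_ us _] _] [[_ vs _] _]; apply: del_lin. Qed.

Lemma delbar_linear p q : linear_on (pqforms p q) (delbar p q).
Proof. by move=> a u v [[_ us _] _] [[_ vs _] _]; apply: delbar_lin. Qed.

Lemma deldelbar_linear p q : linear_on (pqforms p q) (deldelbar p q).
Proof.
move=> a u v [[_ us _] _] [[_ vs _] _]; rewrite /deldelbar delbar_lin//.
by apply: del_lin; apply: delbar_smooth.
Qed.

(* Im (d : C^oo_(k-1)(X) -> C^oo_k(X)), and similarly for the other operators;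
   spaces of forms of negative degree are zero. *)
Definition d_exact (k : nat) : submodule local_forms :=
  if k is k'.+1 then image_submodule (@d_linear k') else zero_submodule.

Definition del_exact (p q : nat) : submodule local_forms :=
  if p is p'.+1 then image_submodule (@del_linear p' q) else zero_submodule.

Definition delbar_exact (p q : nat) : submodule local_forms :=
  if q is q'.+1 then image_submodule (@delbar_linear p q') else zero_submodule.

Definition deldelbar_exact (p q : nat) : submodule local_forms :=
  match p, q with
  | p'.+1, q'.+1 => image_submodule (@deldelbar_linear p' q')
  | _, _ => zero_submodule
  end.

Definition deldelbar_manifold : Prop :=
  forall p q u, pqforms p q u -> dform u = 0 ->
    [<-> d_exact (p + q) u; del_exact p q u; delbar_exact p q u;
         deldelbar_exact p q u].

Definition deRham (k : nat) :=
  quotient_space (ker_submodule (@d_linear k)) (d_exact k).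

Definition aeppli (p q : nat) :=
  quotient_space (ker_submodule (@deldelbar_linear p q))
    (sum_submodule (del_exact p q) (delbar_exact p q)).

Definition closed_representative p q (c : aeppli p q) (w : local_forms) : Prop :=
  [/\ c w, pqforms p q w & dform w = 0].

(* The direct sum of the H_A^(p,q) with p + q = k. *)
Definition aeppli_sum (k : nat) :=
  direct_sum (fun p : 'I_k.+1 => aeppli p (k - p) : lmodType C).

Definition aeppli_classes (p q : nat) : set (set local_forms) :=
  range (fun c : aeppli p q => coset c : set local_forms).

(* The class of w is sent to the class of conj w. *)
Definition conj_class (c : set local_forms) : set local_forms := conj_form @` c.

End GlobalForms.

Arguments aeppli_classes {R n} X p q.

(* Main.v *)
(* On forms of all bidegrees d = del + delbar, where del and delbar square to 0
   and anticommute.  In a chart, d = sum_s e_s /\ D_s, where the D_s are the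
   Wirtinger derivatives, which commute by Schwarz's theorem; del and delbar are
   the partial sums over the dz_a and over the d\bar z_a.  That these operators
   are defined on X is the naturality of d under the transition maps, which are
   holomorphic and therefore respect bidegrees.

   The rest is algebra.  If u is of type (p, q) with del delbar u = 0, then del u
   is d-closed and del-exact, hence del u = del delbar a, and similarly
   delbar u = del delbar b, so that u + del b - delbar a is a closed
   representative.  If del x + delbar y is d-closed of pure type, then so are
   both summands, which are then d-exact.  If a sum of closed forms of pure types
   is d eta, then its components lie in Im del + Im delbar.  Finally, if
   u = sum_p u_p is d-closed, then del u_p is delbar-exact, so that
   del u_p = del delbar a_p, and all the components of u - sum_p d a_p are
   d-closed. *)

Require Import Defs.
From HB Require Import structures.
From mathcomp Require Import all_boot all_order all_algebra complex.
From mathcomp Require Import all_classical all_reals all_analysis.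
From mathcomp Require Import ring.

Set Implicit Arguments.
Unset Strict Implicit.
Unset Printing Implicit Defensive.

Import Order.TTheory GRing.Theory Num.Theory.
Import numFieldNormedType.Exports.
Local Open Scope classical_set_scope.
Local Open Scope complex_scope.
Local Open Scope ring_scope.

(** * Partial derivatives of real functions *)

(** [class_C] speaks only of partial derivatives along the basis vectors, whereas transition maps
    call for a chain rule. Hence the analysis at the start: continuous partial derivatives have to
    yield Fréchet differentiability, and mixed ones have to commute; both come from mean value
    arguments along segments. After that, d is a sum of operators e_s /\ D_s in which the left
    multiplications anticommute and the derivatives commute. Its naturality rests on two facts:
    substituting one-forms for the generators is multiplicative, and the pulled-back generators are
    closed. Globally, [partial_dform P] acts on arbitrary families of local expressions and carries
    no bidegree, so that del delbar = - delbar del is an identity without indices; [del p q] and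
    [delbar p q] are identified with it on forms of type (p, q). As degrees are natural numbers, a
    predecessor of degree 0 is a case of its own, in which the only form is 0. *)

Section PartialDerivatives.
Context (R : realType).

(** Both difference quotients are the same function. Restriction to a line brings one-variable
    theorems to functions that have only a directional derivative. *)
Lemma is_derive_line (V W : normedModType R) (f : V -> W) x v (t : R) :
  derivable f (t *: v + x) v ->
  is_derive t 1 (fun s : R => f (s *: v + x)) ('D_v f (t *: v + x)).
Proof.
move=> df.
have e : (fun h : R => h^-1 *: (((fun s : R => f (s *: v + x)) \o shift t) (h *: (1 : R))
      - f (t *: v + x))) =
    (fun h : R => h^-1 *: ((f \o shift (t *: v + x)) (h *: v) - f (t *: v + x))).
  by apply: funext => h /=; rewrite scalerDl addrA [h *: 1]mulr1.
by apply: DeriveDef; rewrite /derivable /derive e.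
Qed.

Lemma is_derive_shift_left (V W : normedModType R) (f : V -> W) a y v :
  derivable f (a + y) v ->
  is_derive y v (fun y => f (a + y)) ('D_v f (a + y)).
Proof.
move=> df.
have e : (fun t : R => t^-1 *: (((fun y => f (a + y)) \o shift y) (t *: v)
      - f (a + y))) =
    (fun t : R => t^-1 *: ((f \o shift (a + y)) (t *: v) - f (a + y))).
  by apply: funext => t /=; rewrite addrCA.
by apply: DeriveDef; rewrite /derivable /derive e.
Qed.

(** The intermediate point is only bounded by [|t|] in absolute value, which covers both signs of t
    at once. *)
Lemma mean_value_line (V : normedModType R) (f : V -> R) x v (t : R) :
  (forall s : R, `|s| <= `|t| -> derivable f (s *: v + x) v) ->
  exists2 s : R, `|s| <= `|t| & f (t *: v + x) - f x = t * 'D_v f (s *: v + x).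
Proof.
move=> df; pose g (s : R) := f (s *: v + x).
have dg (s : R) : `|s| <= `|t| -> is_derive s 1 g ('D_v f (s *: v + x)).
  by move=> st; apply/is_derive_line/df.
have gc (a b : R) : (forall s, s \in `[a, b]%R -> `|s| <= `|t|) ->
    {within `[a, b], continuous g}.
  move=> ab; apply: derivable_within_continuous => s /ab st.
  by have [] := dg _ st.
have gt0 : f x = g 0 by rewrite /g scale0r add0r.
rewrite -/(g t) gt0; have [t0|t0] := leP 0 t.
  have tb s : s \in `[0, t]%R -> `|s| <= `|t|.
    by rewrite in_itv/= => /andP[s0 st]; rewrite !ger0_norm.
  have [c c0 ->] := MVT_segment t0
    (fun s hs => dg s (tb s (subset_itv_oo_cc hs))) (gc _ _ tb).
  by exists c; [exact: tb | rewrite subr0 mulrC].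
have tb s : s \in `[t, 0]%R -> `|s| <= `|t|.
  by rewrite in_itv/= => /andP[s0 st]; rewrite !ler0_norm ?lerN2// ltW.
have [c c0 e] := MVT_segment (ltW t0)
  (fun s hs => dg s (tb s (subset_itv_oo_cc hs))) (gc _ _ tb).
exists c; [exact: tb | rewrite -opprB e sub0r].
by rewrite mulrN opprK mulrC.
Qed.

(** The mean value theorem is applied to [g] in the direction v, then to the derivative along v in
    the direction w. The left side is symmetric in v and w, which is what Schwarz's theorem
    exploits. *)
Lemma second_difference (V : normedModType R) (f : V -> R) v w z (h : R) :
  (forall s t : R, `|s| <= `|h| -> `|t| <= `|h| ->
     derivable f (t *: w + (s *: v + z)) v /\
     derivable ('D_v f) (t *: w + (s *: v + z)) w) ->
  exists s t : R, [/\ `|s| <= `|h|, `|t| <= `|h| &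
    f (h *: w + (h *: v + z)) - f (h *: w + z) - (f (h *: v + z) - f z)
    = h * (h * 'D_w ('D_v f) (t *: w + (s *: v + z)))].
Proof.
move=> df; pose g y := f (h *: w + y) - f y.
have h0 : `|0 : R| <= `|h| by rewrite normr0.
have dg (s : R) : `|s| <= `|h| -> is_derive (s *: v + z) v g
    ('D_v f (h *: w + (s *: v + z)) - 'D_v f (s *: v + z)).
  move=> sh; have [d1 _] := df s h sh (lexx _); have [d0 _] := df s 0 sh h0.
  rewrite scale0r add0r in d0.
  by have := is_deriveB (is_derive_shift_left d1) (derivableP d0).
have [s sh e1] := mean_value_line
  (fun s hs => @ex_derive _ _ _ _ _ _ _ (dg s hs)).
have [t th e2] := mean_value_line (fun t ht => (df s t sh ht).2).
exists s, t; split => //; rewrite -e2 -(@derive_val _ _ _ _ _ _ _ (dg s sh)) -e1 /g.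
by rewrite !opprB addrACA [RHS]addrACA; congr (_ + _); rewrite addrC.
Qed.

Lemma derive_comm (V : normedModType R) (W : set V) (f : V -> R) (v w : V) z :
  open W -> W z ->
  (forall x, W x -> derivable f x v /\ derivable f x w) ->
  (forall x, W x -> derivable ('D_v f) x w /\ derivable ('D_w f) x v) ->
  {for z, continuous ('D_w ('D_v f))} -> {for z, continuous ('D_v ('D_w f))} ->
  'D_w ('D_v f) z = 'D_v ('D_w f) z.
Proof.
move=> oW Wz d1 d2 c1 c2.
apply/eqP; rewrite -subr_eq0 -normr_le0; apply/ler_addgt0Pr => e e0; rewrite add0r.
have e20 : 0 < e / 2 by rewrite divr_gt0.
have nW : nbhs z W by exact: open_nbhs_nbhs.
have n1 : \forall x \near z, `|'D_w ('D_v f) z - 'D_w ('D_v f) x| <= e / 2.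
  by move/cvgrPdist_le : c1; apply.
have n2 : \forall x \near z, `|'D_v ('D_w f) z - 'D_v ('D_w f) x| <= e / 2.
  by move/cvgrPdist_le : c2; apply.
have [r /= r0 rP] : exists2 r, 0 < r & forall x, `|z - x| < r -> [/\ W x,
    `|'D_w ('D_v f) z - 'D_w ('D_v f) x| <= e / 2 &
    `|'D_v ('D_w f) z - 'D_v ('D_w f) x| <= e / 2].
  have /nbhs_ballP[r r0 hr] : \forall x \near z, [/\ W x,
    `|'D_w ('D_v f) z - 'D_w ('D_v f) x| <= e / 2 &
    `|'D_v ('D_w f) z - 'D_v ('D_w f) x| <= e / 2].
    by apply: filterS3 nW n1 n2 => x ? ? ?.
  by exists r => // x zx; apply: hr; rewrite -ball_normE.
(* With this M both steps of size h stay within h * M = r / 2 of z; the summand 1 keeps M positive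
   when v = w = 0. *)
pose M := `|v| + `|w| + 1; have M0 : 0 < M by rewrite /M ltr_wpDl// addr_ge0.
pose h := r / 2 / M; have h0 : 0 < h by rewrite !divr_gt0.
have hP (s t : R) : `|s| <= `|h| -> `|t| <= `|h| ->
    `|z - (t *: w + (s *: v + z))| < r.
  rewrite !(gtr0_norm h0) => sh th.
  rewrite addrA opprD addrCA subrr addr0 normrN.
  apply: le_lt_trans (ler_normD _ _) _; rewrite !normrZ.
  apply: (@le_lt_trans _ _ (h * M)).
    rewrite /M !mulrDr mulr1 addrC -[leLHS]addr0 !lerD ?ler_wpM2r//; exact: ltW.
  by rewrite /h divfK ?gt_eqF// ltr_pdivrMr// ltr_pMr// ltr1n.
have hP' (s t : R) : `|s| <= `|h| -> `|t| <= `|h| ->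
    `|z - (t *: v + (s *: w + z))| < r.
  by move=> sh th; rewrite addrCA; apply: hP.
have [s [t [sh th e1]]] : exists s t : R, [/\ `|s| <= `|h|, `|t| <= `|h| &
    f (h *: w + (h *: v + z)) - f (h *: w + z) - (f (h *: v + z) - f z)
    = h * (h * 'D_w ('D_v f) (t *: w + (s *: v + z)))].
  apply: second_difference => s t sh th.
  have [Wx _ _] := rP _ (hP s t sh th).
  by split; [have [] := d1 _ Wx | have [] := d2 _ Wx].
have [s' [t' [sh' th' e2]]] : exists s t : R, [/\ `|s| <= `|h|, `|t| <= `|h| &
    f (h *: v + (h *: w + z)) - f (h *: v + z) - (f (h *: w + z) - f z)
    = h * (h * 'D_v ('D_w f) (t *: v + (s *: w + z)))].
  apply: second_difference => s' t' sh' th'.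
  have [Wx _ _] := rP _ (hP' s' t' sh' th').
  by split; [have [] := d1 _ Wx | have [] := d2 _ Wx].
(* The two expressions of the same second difference, divided by h twice. *)
have ee : 'D_w ('D_v f) (t *: w + (s *: v + z)) = 'D_v ('D_w f) (t' *: v + (s' *: w + z)).
  have cancel (A B C : R) : C = h * (h * A) -> C = h * (h * B) -> A = B.
    by move=> -> /mulfI -/(_ (lt0r_neq0 h0))/mulfI -/(_ (lt0r_neq0 h0)).
  apply: cancel e1 _; rewrite -e2 [h *: v + (h *: w + z)]addrCA !opprB.
  by rewrite addrACA [RHS]addrACA; congr (_ + _); rewrite addrC.
have [_ b1 _] := rP _ (hP s t sh th); have [_ _ b2] := rP _ (hP' s' t' sh' th').
rewrite (splitr e); apply: le_trans (lerD b1 b2).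
by rewrite ee [X in _ <= _ + X]distrC; apply: ler_distD.
Qed.
Lemma differentiable_linear_approx (V W : normedModType R) (f : V -> W)
    (df : {linear V -> W}) z : continuous df ->
  (forall e : R, 0 < e ->
    \forall h \near 0, `|f (h + z) - f z - df h| <= e * `|h|) ->
  differentiable f z.
Proof.
move=> dfc dfO; have fO : f \o shift z = cst (f z) + df +o_ 0 id.
  apply/eqaddoP => e e0; apply: filterS (dfO e e0) => h.
  by rewrite -addrA -opprD.
by apply/diff_locallyP; rewrite (diff_unique dfc fO); split.
Qed.

(** The increment h is made one coordinate at a time. Each move is a mean value along a basis
    vector, at a point so close to z that the partial derivative there differs little from its value
    at z. *)
Lemma continuous_partials_differentiable m (W : set 'rV[R]_m) (f : 'rV[R]_m -> R) z :
  open W -> W z ->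
  (forall s x, W x -> derivable f x (delta_mx 0 s)) ->
  (forall s, {for z, continuous ('D_(delta_mx 0 s) f)}) ->
  differentiable f z.
Proof.
move=> oW Wz df dc.
pose e_ s : 'rV[R]_m := delta_mx 0 s.
pose d (h : 'rV[R]_m) := \sum_s h 0 s * 'D_(e_ s) f z.
have dlin : linear d.
  move=> a u v; rewrite /d scaler_sumr -big_split /=; apply: eq_bigr => s _.
  by rewrite !mxE mulrDl -mulrA.
pose dM := GRing.isLinear.Build _ _ _ _ _ dlin.
pose dL : {linear 'rV[R]_m -> R} := HB.pack d dM.
have dcont : continuous dL.
  apply: continuous_big => [|s _ x]; first exact: add_continuous.
  apply: (@continuousM _ _ (fun y : 'rV[R]_m => y 0 s : R) (cst ('D_(e_ s) f z)) x).
    exact: coord_continuous.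
  exact: cst_continuous.
apply: (differentiable_linear_approx dcont) => e e0.
  have m0 : 0 < m%:R + 1 :> R by rewrite ltr_wpDl.
  (* There are m moves, each with error at most e / (m + 1) times the norm of h; the 1 allows for m
     = 0. *)
  have em : 0 < e / (m%:R + 1) by rewrite divr_gt0.
  have nd : \forall x \near z, W x /\ forall s,
      `|'D_(e_ s) f z - 'D_(e_ s) f x| <= e / (m%:R + 1).
    apply: filterS2 (open_nbhs_nbhs (conj oW Wz)) (_ : \forall x \near z, forall s,
      `|'D_(e_ s) f z - 'D_(e_ s) f x| <= e / (m%:R + 1)) => //.
    apply: (@filter_forall _ _ _ _ (nbhs_filter z)) => s.
    by move/cvgrPdist_le : (dc s); apply.
  have /nbhs_ballP[r /= r0 rP] := nd.
  have nr : \forall h \near (0 : 'rV[R]_m), `|h| < r.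
    by apply/nbhs_ballP; exists r => // h; rewrite -ball_normE /= sub0r normrN.
  apply: filterS nr => h hr.
  (* The first k coordinates of h, the others being 0: the path from 0 to h along which the
     increments telescope. *)
  pose hk k : 'rV[R]_m := \row_j (if (j < k)%N then h 0 j else 0).
  have hkS (s : 'I_m) : hk s.+1 = h 0 s *: e_ s + hk s.
    apply/rowP => j; rewrite !mxE eqxx /= ltnS leq_eqVlt.
    have [->|js] := eqVneq j s; first by rewrite ltnn eqxx mulr1 addr0.
    by rewrite val_eqE (negPf js) mulr0 add0r.
  have hk0 : hk 0%N = 0 by apply/rowP => j; rewrite !mxE.
  have hkm : hk m = h by apply/rowP => j; rewrite !mxE ltn_ord.
  have coordh s : `|h 0 s| <= `|h|.
    rewrite [leRHS]/Num.Def.normr /= mx_normrE.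
    exact: (le_bigmax _ (fun i : 'I_1 * 'I_m => `|h i.1 i.2|) (0, s)).
  have small (s : 'I_m) (t : R) : `|t| <= `|h 0 s| -> `|t *: e_ s + hk s| <= `|h|.
    move=> th; rewrite [leLHS]/Num.Def.normr /= mx_normrE.
    apply: bigmax_le => // -[i j] _ /=; rewrite ord1 !mxE eqxx /=.
    have [->|js] := eqVneq j s.
      by rewrite ltnn mulr1 addr0; apply: le_trans th (coordh s).
    by rewrite mulr0 add0r; case: ifP => // _; rewrite normr0.
  have inW (s : 'I_m) (t : R) : `|t| <= `|h 0 s| -> 
      W (t *: e_ s + (hk s + z)) /\ forall s',
      `|'D_(e_ s') f z - 'D_(e_ s') f (t *: e_ s + (hk s + z))| <= e / (m%:R + 1).
    move=> th; apply: rP; rewrite -ball_normE /= addrA opprD addrCA subrr addr0 normrN.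
    exact: le_lt_trans (small s t th) hr.
  have step (s : 'I_m) : `|f (hk s.+1 + z) - f (hk s + z) - h 0 s * 'D_(e_ s) f z|
      <= e / (m%:R + 1) * `|h|.
    have dl (t : R) : `|t| <= `|h 0 s| -> derivable f (t *: e_ s + (hk s + z)) (e_ s).
      by move=> th; apply: df; have [] := inW _ _ th.
    have [t th e1] := mean_value_line dl.
    rewrite hkS -[_ + hk s + z]addrA e1 -mulrBr normrM mulrC.
    apply: ler_pM => //; rewrite distrC; exact: (inW s t th).2.
  have -> : f (h + z) - f z - dL h =
      \sum_(s < m) (f (hk s.+1 + z) - f (hk s + z) - h 0 s * 'D_(e_ s) f z).
    rewrite sumrB -(big_mkord xpredT (fun k => f (hk k.+1 + z) - f (hk k + z))).
    rewrite telescope_sumr// hkm hk0 add0r; done.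
  apply: le_trans (ler_norm_sum _ _ _) _.
  apply: (@le_trans _ _ (\sum_(s < m) (e / (m%:R + 1) * `|h|))).
    by apply: ler_sum => s _; apply: step.
  rewrite sumr_const card_ord -[_ *+ m]mulr_natl mulrA ler_wpM2r//.
  by rewrite mulrCA ler_piMr ?(ltW e0)// ler_pdivrMr// mul1r lerDl.
Qed.

(** The inner map is only known to be derivable along v. Replacing it by the curve [g] of one real
    variable, where derivable means differentiable, makes the chain rule for differentials
    applicable. *)
Lemma derive_comp_partials (V : normedModType R) m (h : 'rV[R]_m -> R)
    (f : V -> 'rV[R]_m) z v :
  differentiable h (f z) -> (forall r, derivable (fun y => f y 0 r) z v) ->
  derivable (h \o f) z v /\
  'D_v (h \o f) z = \sum_r 'D_v (fun y => f y 0 r) z * 'D_(delta_mx 0 r) h (f z).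
Proof.
move=> dh dfr; have df : derivable f z v.
  by apply/derivable_mxP => i j; rewrite ord1.
pose g (t : R) := f (t *: v + z).
have g0 : g 0 = f z by rewrite /g scale0r add0r.
have dg : is_derive (0 : R) 1 g ('D_v f z).
  by have := @is_derive_line V _ f z v 0; rewrite scale0r add0r; apply.
have dfg : differentiable g 0.
  by apply: (derivable1_diffP g 0).1; exact: (@ex_derive _ _ _ _ _ _ _ dg).
have dh' : differentiable h (g 0) by rewrite g0.
have dc := differentiable_comp dfg dh'.
have dhf : derivable (h \o f) z v.
  by apply/derivable1P/derivable1_diffP.
split=> //.
have : is_derive (0 : R) 1 (h \o g) ('D_v (h \o f) z).
  by have := @is_derive_line V _ (h \o f) z v 0; rewrite scale0r add0r; apply.
move=> /@derive_val <-. rewrite (deriveE _ dc) diff_comp//=.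
rewrite -(deriveE _ dfg) (@derive_val _ _ _ _ _ _ _ dg) g0.
rewrite derive_mx// [X in 'd h _ X]matrix_sum_delta linear_sum big_ord1.
rewrite linear_sum; apply: eq_bigr => r _.
by rewrite linearZ/= mxE (deriveE _ dh).
Qed.
End PartialDerivatives.

(** * Wirtinger derivatives *)

Section Wirtinger.
Context (R : realType) (n : nat).
Local Notation C := (R[i]).
Local Notation V := ('rV[R]_(n + n)).
Local Notation D := (@cpderiv R n).
Implicit Types (f g : V -> C) (s r : 'I_(n + n)) (z : V).

(** Products and composites of coefficients are differentiated only once in the sequel, so existence
    of the first partial derivatives at the given point is the property to carry along. *)
Definition cderivable f z := forall s,
  derivable (fun y => complex.Re (f y)) z (delta_mx 0 s) /\
  derivable (fun y => complex.Im (f y)) z (delta_mx 0 s).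

Lemma complex_eta (x y : C) : complex.Re x = complex.Re y ->
  complex.Im x = complex.Im y -> x = y.
Proof. by case: x y => [a b] [c d] /= -> ->. Qed.

Lemma smooth_cderivable W f z : smooth W f -> W z -> cderivable f z.
Proof.
by move=> hf Wz s; have [[_ f1] [_ f2]] := hf 1%N; split;
  [apply: (f1 s).1 | apply: (f2 s).1].
Qed.

Lemma cderivable_cst (c : C) z : cderivable (fun=> c) z.
Proof. by move=> s; split; apply: derivable_cst. Qed.

Lemma cderivableD f g z : cderivable f z -> cderivable g z ->
  cderivable (fun y => f y + g y) z.
Proof.
move=> df dg s; have [f1 f2] := df s; have [g1 g2] := dg s.
have -> : (fun y => complex.Re (f y + g y)) =
    (fun y => complex.Re (f y)) + (fun y => complex.Re (g y)).
  by apply: funext => y; rewrite fctE; case: (f y) (g y) => [? ?] [? ?].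
have -> : (fun y => complex.Im (f y + g y)) =
    (fun y => complex.Im (f y)) + (fun y => complex.Im (g y)).
  by apply: funext => y; rewrite fctE; case: (f y) (g y) => [? ?] [? ?].
by split; [exact: derivableD f1 g1 | exact: derivableD f2 g2].
Qed.

Lemma ReM_fun f g : (fun y => complex.Re (f y * g y)) =
  (fun y => complex.Re (f y)) * (fun y => complex.Re (g y))
  - (fun y => complex.Im (f y)) * (fun y => complex.Im (g y)).
Proof. by apply: funext => y; rewrite !fctE; case: (f y) (g y) => [? ?] [? ?]. Qed.

Lemma ImM_fun f g : (fun y => complex.Im (f y * g y)) =
  (fun y => complex.Re (f y)) * (fun y => complex.Im (g y))
  + (fun y => complex.Im (f y)) * (fun y => complex.Re (g y)).
Proof. by apply: funext => y; rewrite !fctE; case: (f y) (g y) => [? ?] [? ?]. Qed.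

Lemma cderivableM f g z : cderivable f z -> cderivable g z ->
  cderivable (fun y => f y * g y) z.
Proof.
move=> df dg s; have [f1 f2] := df s; have [g1 g2] := dg s.
rewrite ReM_fun ImM_fun; split.
  exact: derivableB (derivableM f1 g1) (derivableM f2 g2).
exact: derivableD (derivableM f1 g2) (derivableM f2 g1).
Qed.

Lemma cderivable_conj f z : cderivable f z -> cderivable (fun y => (f y)^*%C) z.
Proof.
move=> df s; have [f1 f2] := df s.
have -> : (fun y => complex.Re (f y)^*%C) = (fun y => complex.Re (f y)).
  by apply: funext => y; case: (f y).
have -> : (fun y => complex.Im (f y)^*%C) = - (fun y => complex.Im (f y)).
  by apply: funext => y; rewrite fctE; case: (f y).
by split; [exact: f1 | exact: derivableN f2].
Qed.

Lemma cderivable_sum (I : Type) (l : seq I) (P : pred I) (F : I -> V -> C) z :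
  (forall i, cderivable (F i) z) ->
  cderivable (fun y => \sum_(i <- l | P i) F i y) z.
Proof.
move=> dF; elim: l => [|i l IH].
  have -> : (fun y => \sum_(i <- [::] | P i) F i y) = (fun=> 0 : C).
    by apply: funext => y; rewrite big_nil.
  exact: cderivable_cst.
case Pi : (P i).
  have -> : (fun y => \sum_(i <- i :: l | P i) F i y) =
      (fun y => F i y + \sum_(i <- l | P i) F i y).
    by apply: funext => y; rewrite big_cons Pi.
  exact: cderivableD (dF i) IH.
have -> // : (fun y => \sum_(i <- i :: l | P i) F i y) =
    (fun y => \sum_(i <- l | P i) F i y).
by apply: funext => y; rewrite big_cons Pi.
Qed.

Lemma cpderiv_cst s (c : C) z : D s (fun=> c) z = 0.
Proof. by rewrite /cpderiv /pderiv !derive_cst. Qed.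

Lemma cpderivD s f g z : cderivable f z -> cderivable g z ->
  D s (fun y => f y + g y) z = D s f z + D s g z.
Proof.
move=> /(_ s)[f1 f2] /(_ s)[g1 g2]; rewrite /cpderiv /pderiv.
have -> : (fun y => complex.Re (f y + g y)) =
    (fun y => complex.Re (f y)) + (fun y => complex.Re (g y)).
  by apply: funext => y; rewrite fctE; case: (f y) (g y) => [? ?] [? ?].
have -> : (fun y => complex.Im (f y + g y)) =
    (fun y => complex.Im (f y)) + (fun y => complex.Im (g y)).
  by apply: funext => y; rewrite fctE; case: (f y) (g y) => [? ?] [? ?].
by rewrite (deriveD f1 g1) (deriveD f2 g2).
Qed.

Lemma cpderivM s f g z : cderivable f z -> cderivable g z ->
  D s (fun y => f y * g y) z = D s f z * g z + f z * D s g z.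
Proof.
move=> /(_ s)[f1 f2] /(_ s)[g1 g2]; rewrite /cpderiv /pderiv ReM_fun ImM_fun.
rewrite (deriveB (derivableM f1 g1) (derivableM f2 g2)).
rewrite (deriveD (derivableM f1 g2) (derivableM f2 g1)).
rewrite (deriveM f1 g1) (deriveM f2 g2) (deriveM f1 g2) (deriveM f2 g1) /GRing.scale /=.
move: ('D__ (fun y => complex.Re (f y)) z) ('D__ (fun y => complex.Im (f y)) z).
move: ('D__ (fun y => complex.Re (g y)) z) ('D__ (fun y => complex.Im (g y)) z).
case: (f z) (g z) => [a b] [c d] p q p' q' /=.
by apply: complex_eta => /=; ring.
Qed.

Lemma cpderivZ s (c : C) f z : cderivable f z ->
  D s (fun y => c * f y) z = c * D s f z.
Proof.
by move=> df; rewrite (cpderivM s (cderivable_cst c z) df) cpderiv_cst mul0r add0r.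
Qed.

Lemma cpderiv_conj s f z : cderivable f z ->
  D s (fun y => (f y)^*%C) z = (D s f z)^*%C.
Proof.
move=> /(_ s)[f1 f2]; rewrite /cpderiv /pderiv.
have -> : (fun y => complex.Re (f y)^*%C) = (fun y => complex.Re (f y)).
  by apply: funext => y; case: (f y).
have -> : (fun y => complex.Im (f y)^*%C) = - (fun y => complex.Im (f y)).
  by apply: funext => y; rewrite fctE; case: (f y).
by rewrite (deriveN f2).
Qed.

Lemma cpderiv_comm W s r f z : open W -> W z -> smooth W f ->
  D s (D r f) z = D r (D s f) z.
Proof.
move=> oW Wz hf; have [[_ f1] [_ f2]] := hf 2%N.
have comm (h : V -> R) : (forall t, (forall y, W y -> derivable h y (delta_mx 0 t))
    /\ class_C 1 W (pderiv t h)) -> pderiv s (pderiv r h) z = pderiv r (pderiv s h) z.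
  move=> hh; apply: (derive_comm oW Wz).
  - by move=> y Wy; split; apply: (hh _).1.
  - move=> y Wy; split; first by have [_ [_ /(_ s)[+ _]]] := hh r; apply.
    by have [_ [_ /(_ r)[+ _]]] := hh s; apply.
  - by have [_ [_ /(_ s)[_ [+ _]]]] := hh r; apply.
  - by have [_ [_ /(_ r)[_ [+ _]]]] := hh s; apply.
by apply: complex_eta; [exact: comm f1 | exact: comm f2].
Qed.

Lemma class_C1_differentiable W (f : V -> R) z : open W -> W z ->
  class_C 1 W f -> differentiable f z.
Proof.
move=> oW Wz [_ hf]; apply: (continuous_partials_differentiable oW Wz).
  by move=> s x; apply: (hf s).1.
by move=> s; have [_ [+ _]] := hf s; apply.
Qed.

Definition real_derivable (f : V -> V) z := forall r s,
  derivable (fun y => f y 0 r) z (delta_mx 0 s).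

Lemma cderivable_comp W (h : V -> C) (f : V -> V) z : open W -> W (f z) ->
  smooth W h -> real_derivable f z -> cderivable (fun y => h (f y)) z.
Proof.
move=> oW Wz hh df s; have [h1 h2] := hh 1%N.
by split; [apply: (derive_comp_partials (class_C1_differentiable oW Wz h1) (df^~ s)).1
  | apply: (derive_comp_partials (class_C1_differentiable oW Wz h2) (df^~ s)).1].
Qed.

Lemma cpderiv_comp W s (h : V -> C) (f : V -> V) z : open W -> W (f z) ->
  smooth W h -> real_derivable f z ->
  D s (fun y => h (f y)) z =
    \sum_r (pderiv s (fun y => f y 0 r) z)%:C * D r h (f z).
Proof.
move=> oW Wz hh df; have [h1 h2] := hh 1%N; rewrite /cpderiv /pderiv.
rewrite (derive_comp_partials (class_C1_differentiable oW Wz h1) (df^~ s)).2.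
rewrite (derive_comp_partials (class_C1_differentiable oW Wz h2) (df^~ s)).2.
apply: complex_eta; rewrite raddf_sum /=; apply: eq_bigr => r _ /=.
  by rewrite mul0r subr0.
by rewrite mul0r addr0.
Qed.

Lemma split_lshift (a : 'I_n) : fintype.split (lshift n a) = inl a.
Proof. exact: (unsplitK (inl a)). Qed.

Lemma split_rshift (a : 'I_n) : fintype.split (rshift n a) = inr a.
Proof. exact: (unsplitK (inr a)). Qed.

(** The derivatives in z_a and \bar z_a differ by this sign alone, so that one formula and one sum
    over 2n indices serve for both. *)
Definition wirt_sign s : C := if fintype.split s is inl _ then - 'i%C else 'i%C.

Definition cbase s : 'I_n := match fintype.split s with inl a => a | inr a => a end.

(* The derivative with respect to z_a for [s = lshift n a], and with respect to
   \bar z_a for [s = rshift n a]. *)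
Definition wirt s f z : C :=
  2^-1 * (D (lshift n (cbase s)) f z + wirt_sign s * D (rshift n (cbase s)) f z).

Lemma wirt_lshift a f z : wirt (lshift n a) f z = wirtinger a f z.
Proof. by rewrite /wirt /wirt_sign /cbase split_lshift mulNr. Qed.

Lemma wirt_rshift a f z : wirt (rshift n a) f z = wirtinger_bar a f z.
Proof. by rewrite /wirt /wirt_sign /cbase split_rshift. Qed.

Lemma big_split_shift (T : Type) (idx : T) (op : Monoid.com_law idx)
    (F : 'I_(n + n) -> T) :
  \big[op/idx]_s F s = \big[op/idx]_(a < n) op (F (lshift n a)) (F (rshift n a)).
Proof. by rewrite big_split_ord /= -big_split. Qed.

Lemma differentialE f z : differential f z = \sum_s wirt s f z *: ext_gen C s.
Proof.
rewrite big_split_shift; apply: eq_bigr => a _.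
by rewrite wirt_lshift wirt_rshift.
Qed.

Lemma wirt_near s f g z : (\forall y \near z, f y = g y) -> wirt s f z = wirt s g z.
Proof.
move=> fg; rewrite /wirt /cpderiv /pderiv.
have E (p : C -> R) t : 'D_(delta_mx 0 t) (fun y => p (f y)) z =
    'D_(delta_mx 0 t) (fun y => p (g y)) z.
  by apply: near_eq_derive; apply: filterS fg => y ->.
by rewrite !(E (@complex.Re R)) !(E (@complex.Im R)).
Qed.

Lemma wirt_cst s (c : C) z : wirt s (fun=> c) z = 0.
Proof. by rewrite /wirt !cpderiv_cst mulr0 addr0 mulr0. Qed.

Lemma wirtD s f g z : cderivable f z -> cderivable g z ->
  wirt s (fun y => f y + g y) z = wirt s f z + wirt s g z.
Proof.
move=> df dg; rewrite /wirt !(cpderivD _ df dg).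
by rewrite [wirt_sign s * _]mulrDr addrACA mulrDr.
Qed.

Lemma wirtM s f g z : cderivable f z -> cderivable g z ->
  wirt s (fun y => f y * g y) z = wirt s f z * g z + f z * wirt s g z.
Proof.
move=> df dg; rewrite /wirt !(cpderivM _ df dg).
move: (f z) (g z) (D _ f z) (D _ f z) (D _ g z) (D _ g z) (wirt_sign s).
by move=> a b p q p' q' e; ring.
Qed.

Lemma wirtZ s (c : C) f z : cderivable f z ->
  wirt s (fun y => c * f y) z = c * wirt s f z.
Proof.
move=> df; rewrite /wirt !(cpderivZ _ _ df).
by rewrite [wirt_sign s * _]mulrCA -mulrDr mulrCA.
Qed.

Lemma wirt_sum s (I : Type) (l : seq I) (P : pred I) (F : I -> V -> C) z :
  (forall i, cderivable (F i) z) ->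
  wirt s (fun y => \sum_(i <- l | P i) F i y) z
  = \sum_(i <- l | P i) wirt s (F i) z.
Proof.
move=> dF; elim: l => [|i l IH].
  rewrite big_nil -[RHS](wirt_cst s 0 z); congr (wirt s _ z).
  by apply: funext => y; rewrite big_nil.
rewrite big_cons; case Pi : (P i).
  rewrite -IH -(wirtD _ (dF i) (cderivable_sum _ _ dF)).
  by congr (wirt s _ z); apply: funext => y; rewrite big_cons Pi.
by rewrite -IH; congr (wirt s _ z); apply: funext => y; rewrite big_cons Pi.
Qed.

Definition cswap s : 'I_(n + n) :=
  match fintype.split s with inl a => rshift n a | inr a => lshift n a end.

Lemma cswap_lshift a : cswap (lshift n a) = rshift n a.
Proof. by rewrite /cswap split_lshift. Qed.

Lemma cswap_rshift a : cswap (rshift n a) = lshift n a.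
Proof. by rewrite /cswap split_rshift. Qed.

Lemma cswapK : involutive cswap.
Proof.
by move=> s; case: (split_ordP s) => a ->;
  rewrite ?cswap_lshift ?cswap_rshift ?cswap_lshift.
Qed.

Lemma cbase_cswap s : cbase (cswap s) = cbase s.
Proof.
by case: (split_ordP s) => a ->;
  rewrite ?cswap_lshift ?cswap_rshift /cbase ?split_lshift ?split_rshift.
Qed.

Lemma wirt_sign_cswap s : (wirt_sign (cswap s))^*%C = wirt_sign s.
Proof.
by case: (split_ordP s) => a ->; rewrite ?cswap_lshift ?cswap_rshift /wirt_sign
  ?split_lshift ?split_rshift; apply: complex_eta => /=; rewrite ?oppr0 ?opprK.
Qed.

Lemma conjcD (x y : C) : (x + y)^*%C = x^*%C + y^*%C.
Proof. exact: rmorphD. Qed.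

Lemma conjcM (x y : C) : (x * y)^*%C = x^*%C * y^*%C.
Proof. exact: rmorphM. Qed.

Lemma conjc_half : (2^-1 : C)^*%C = 2^-1.
Proof. by rewrite [LHS]fmorphV [X in X^-1]rmorph_nat. Qed.

Lemma wirt_conj s f z : cderivable f z ->
  wirt s (fun y => (f y)^*%C) z = (wirt (cswap s) f z)^*%C.
Proof.
move=> df; rewrite /wirt !cpderiv_conj//.
by rewrite conjcM conjcD conjcM wirt_sign_cswap cbase_cswap conjc_half.
Qed.

Lemma smooth_wirt W s f : open W -> smooth W f -> smooth W (wirt s f).
Proof.
move=> oW hf; case: (split_ordP s) => a ->.
  exact: smooth_ext oW (fun z _ => esym (wirt_lshift a f z))
    (smooth_wirtinger a oW hf).
exact: smooth_ext oW (fun z _ => esym (wirt_rshift a f z))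
  (smooth_wirtinger_bar a oW hf).
Qed.

(** Wirtinger derivatives are combinations with constant coefficients of the real partial
    derivatives, which commute by [cpderiv_comm]. *)
Lemma wirt_comm W s r f z : open W -> W z -> smooth W f ->
  wirt s (wirt r f) z = wirt r (wirt s f) z.
Proof.
move=> oW Wz hf; pose A x y := D x (D y f) z.
have AC x y : A x y = A y x := cpderiv_comm x y oW Wz hf.
have E s' r' : wirt s' (wirt r' f) z = 2^-1 * (2^-1 *
    (A (lshift n (cbase s')) (lshift n (cbase r'))
     + wirt_sign r' * A (lshift n (cbase s')) (rshift n (cbase r')))
    + wirt_sign s' * (2^-1 *
    (A (rshift n (cbase s')) (lshift n (cbase r'))
     + wirt_sign r' * A (rshift n (cbase s')) (rshift n (cbase r'))))).
  rewrite {1}/wirt.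
  have dD t : cderivable (D t f) z.
    exact: smooth_cderivable (smooth_cpderiv t oW hf) Wz.
  have dM t : cderivable (fun y => wirt_sign r' * D t f y) z.
    exact: cderivableM (cderivable_cst _ _) (dD t).
  by rewrite !(cpderivZ _ _ (cderivableD (dD _) (dM _))) !(cpderivD _ (dD _) (dM _))
    !(cpderivZ _ _ (dD _)).
rewrite (E s r) (E r s) (AC (lshift n (cbase s))) (AC (rshift n (cbase s))).
rewrite (AC (lshift n (cbase s)) (rshift n (cbase r))).
rewrite (AC (rshift n (cbase s)) (rshift n (cbase r))).
move: (A _ _) (A _ _) (A _ _) (A _ _) (wirt_sign s) (wirt_sign r).
by move=> a b c d e e'; ring.
Qed.

(** The functions z_a and \bar z_a indexed like the generators, so that the generator of index s is
    the differential of [ccoord s]. *)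
Definition ccoord s (z : V) : C :=
  match fintype.split s with inl a => zcoord a z | inr a => (zcoord a z)^*%C end.

Lemma cpderiv_ccoord s r (f : V -> V) z : real_derivable f z ->
  D s (fun y => ccoord r (f y)) z =
  (pderiv s (fun y => f y 0 (lshift n (cbase r))) z)%:C
  - wirt_sign r * (pderiv s (fun y => f y 0 (rshift n (cbase r))) z)%:C.
Proof.
move=> df; rewrite /ccoord /wirt_sign /cbase /cpderiv /pderiv.
by case: (fintype.split r) => a; apply: complex_eta => /=;
   rewrite ?[X in 'D__ X]funeqE ?deriveN; try ring; exact: df.
Qed.

(** Since [wirt s] is a fixed combination of real partial derivatives, the formula for these
    suffices. There, with A and B the derivatives of h in x_a and y_a, it reads A x + B y = (A - i
    B) (x + i y) / 2 + (A + i B) (x - i y) / 2. *)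
Lemma wirt_comp W s (h : V -> C) (f : V -> V) z : open W -> W (f z) ->
  smooth W h -> real_derivable f z ->
  wirt s (fun y => h (f y)) z =
    \sum_r wirt r h (f z) * wirt s (fun y => ccoord r (f y)) z.
Proof.
move=> oW Wz hh df.
have E t : D t (fun y => h (f y)) z =
    \sum_r wirt r h (f z) * D t (fun y => ccoord r (f y)) z.
  rewrite (cpderiv_comp t oW Wz hh df) !big_split_shift; apply: eq_bigr => a _ /=.
  rewrite !(cpderiv_ccoord _ _ df) /wirt /wirt_sign /cbase !split_lshift !split_rshift.
  move: (D (lshift n a) h (f z)) (D (rshift n a) h (f z)) => A B.
  move: (pderiv _ _ z)%:C (pderiv _ _ z)%:C => x y.
  have ii : 'i%C * 'i%C = -1 :> C by rewrite -expr2 sqr_i.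
  by field: ii.
rewrite [LHS]/wirt !E mulr_sumr -big_split mulr_sumr /=; apply: eq_bigr => r _.
by rewrite [X in _ = _ * X]/wirt mulrCA -mulrDr mulrCA.
Qed.
End Wirtinger.

(** * Exterior algebra *)

Section Exterior.
Local Open Scope set_scope.
Local Open Scope ring_scope.
Context (K : numDomainType) (m : nat).
Local Notation L := (ext_alg K m).
Local Notation gen := (ext_gen K).
Implicit Types (u v : L) (s r : 'I_m) (S : {set 'I_m}).

Lemma wedge_linear_r u : linear (wedge u : L -> L).
Proof.
move=> a v w; apply/ffunP => S; rewrite !ffunE scaler_sumr -big_split /=.
apply: eq_bigr => A _; rewrite !ffunE mulrDr; congr (_ + _).
by rewrite /GRing.scale /= mulrCA.
Qed.
HB.instance Definition _ u :=
  GRing.isLinear.Build K L L _ (wedge u : L -> L) (wedge_linear_r u).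

Lemma wedge_linear_l v : linear (fun u => wedge u v : L).
Proof. by move=> a u w; exact: wedgeP. Qed.

Lemma ext_subst_linear (t : 'I_m -> L) : linear (ext_subst t : L -> L).
Proof. by move=> a u v; exact: ext_substP. Qed.
HB.instance Definition _ t :=
  GRing.isLinear.Build K L L _ (ext_subst t : L -> L) (ext_subst_linear t).

Lemma wedge_suml (I : Type) (l : seq I) (P : pred I) (F : I -> L) v :
  wedge (\sum_(i <- l | P i) F i) v = \sum_(i <- l | P i) wedge (F i) v.
Proof.
pose f : {linear L -> L} := HB.pack (fun u => wedge u v : L)
  (GRing.isLinear.Build K L L _ (fun u => wedge u v : L) (wedge_linear_l v)).
exact: (linear_sum f).
Qed.

Lemma wedgeZl (a : K) u v : wedge (a *: u) v = a *: wedge u v :> L.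
Proof.
have w0 : wedge 0 v = 0 :> L.
  by have := @wedge_suml void [::] xpredT (fun=> 0) v; rewrite !big_nil.
by rewrite -[a *: u]addr0 wedgeP w0 addr0.
Qed.

Lemma ext_basis_sum u : u = \sum_S u S *: ext_basis K S.
Proof.
apply/ffunP => T; rewrite sum_ffunE (bigD1 T)//= big1 ?addr0.
  by rewrite !ffunE eqxx [RHS]mulr1.
by move=> S ST; rewrite !ffunE eq_sym (negPf ST) [LHS]mulr0.
Qed.

(** The number of transpositions that bring e_s to its place in e_S. *)
Definition below s S := #|[set x in S | (x < s)%N]|.

(** The products below are iterated left multiplications by one-forms, so the signs all derive from
    this formula. Only the subset A = {s} contributes to the sum defining [wedge]. *)
Lemma wedge_genE s u S : wedge (gen s) u S =
  if s \in S then (-1) ^+ below s S * u (S :\ s) else 0.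
Proof.
rewrite ffunE; case: ifPn => sS; last first.
  apply: big1 => A AS; rewrite ffunE; case: eqP AS => [-> | _ _].
    by rewrite finset.sub1set (negPf sS).
  by rewrite mulr0 mul0r.
rewrite (bigD1 [set s]) ?finset.sub1set//= big1 => [|A /andP[_ As]]; last first.
  by rewrite ffunE (negPf As) mulr0 mul0r.
rewrite addr0 ffunE eqxx mulr1; congr (_ * _); rewrite /shuffle_sign; congr (_ ^+ _).
rewrite /below -[RHS](card_imset _ (_ : injective (pair s))); last by move=> x y [].
apply: fintype.eq_card => -[x y]; rewrite inE /=; apply/idP/imsetP => [|[z + [-> ->]]].
  move=> /and3P[/set1P -> yS ys]; exists y => //; rewrite inE ys andbT.
  by move: yS; rewrite finset.in_setD1 => /andP[].
rewrite inE => /andP[zS zs]; rewrite !inE eqxx zS zs !andbT /=.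
by apply: contraTN zs => /eqP ->; rewrite ltnn.
Qed.

Lemma below_D1 s r S : r \in S -> below s S = ((r < s) + below s (S :\ r))%N.
Proof.
move=> rS; rewrite /below (cardsD1 r) inE rS; congr (_ + _)%N.
by apply: fintype.eq_card => x; rewrite !inE; case: (x == r).
Qed.

Lemma wedge_gen_anticomm s r u :
  wedge (gen s) (wedge (gen r) u) = - wedge (gen r) (wedge (gen s) u).
Proof.
apply/ffunP => S; rewrite [RHS]ffunE !wedge_genE !finset.in_setD1.
have [->|sr] /= := eqVneq s r; first by case: ifP => //; rewrite ?mulr0 ?oppr0.
case: (boolP (s \in S)) => sS; case: (boolP (r \in S)) => rS; rewrite ?mulr0 ?oppr0//.
rewrite (below_D1 s rS) (below_D1 r sS) finset.setDDl finset.setUC -finset.setDDl.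
rewrite !exprD -!mulrA.
case: ltngtP sr => [sr|rs|/val_inj->]; rewrite ?eqxx// => _.
  by rewrite /= expr0 expr1 mulN1r mul1r mulrCA.
by rewrite /= expr0 expr1 mulN1r opprK mul1r mulrCA.
Qed.

(** Symmetric coefficients against anticommuting generators. F will hold second derivatives: P = Q
    gives squares equal to 0, distinct P and Q the anticommutation of del and delbar. *)
Lemma sym_wedge_gen_swap (F : 'I_m -> 'I_m -> L) (P Q : pred 'I_m) :
  (forall s r, F s r = F r s) ->
  \sum_(s | P s) \sum_(r | Q r) wedge (gen s) (wedge (gen r) (F s r)) =
  - \sum_(s | Q s) \sum_(r | P r) wedge (gen s) (wedge (gen r) (F s r)).
Proof.
move=> FC; rewrite exchange_big -sumrN; apply: eq_bigr => s _; rewrite -sumrN.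
by apply: eq_bigr => r _; rewrite FC wedge_gen_anticomm.
Qed.

(** Turns anticommutation of an operator with itself into vanishing of its square; the
    characteristic of K is 0. *)
Lemma ext_eqN0 u : u = - u -> u = 0.
Proof.
move=> /ffunP e; apply/ffunP => S; have := e S; rewrite !ffunE => /eqP.
by rewrite eq_sym eqNr => /eqP.
Qed.

Definition ext_oneform (a : 'I_m -> K) : L := \sum_s a s *: gen s.

Lemma wedge_oneformE a u : wedge (ext_oneform a) u = \sum_s a s *: wedge (gen s) u.
Proof. by rewrite wedge_suml; apply: eq_bigr => s _; rewrite wedgeZl. Qed.

Lemma wedge_oneform2 a b u : wedge (ext_oneform a) (wedge (ext_oneform b) u) =
  \sum_s \sum_r (a s * b r) *: wedge (gen s) (wedge (gen r) u).
Proof.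
rewrite wedge_oneformE; apply: eq_bigr => s _.
rewrite wedge_oneformE linear_sum scaler_sumr; apply: eq_bigr => r _.
by rewrite linearZ/= scalerA.
Qed.

Lemma wedge_oneform_anticomm a b u :
  wedge (ext_oneform a) (wedge (ext_oneform b) u) =
  - wedge (ext_oneform b) (wedge (ext_oneform a) u).
Proof.
rewrite !wedge_oneform2 exchange_big -sumrN; apply: eq_bigr => s _.
rewrite -sumrN; apply: eq_bigr => r _.
by rewrite wedge_gen_anticomm mulrC scalerN.
Qed.

Lemma wedge_oneform_alt a u : wedge (ext_oneform a) (wedge (ext_oneform a) u) = 0.
Proof. by apply: ext_eqN0; rewrite {1}wedge_oneform_anticomm. Qed.

Lemma ext_gen_oneform s : gen s = ext_oneform (fun r => (r == s)%:R).
Proof.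
rewrite /ext_oneform (bigD1 s)//= eqxx scale1r big1 ?addr0// => r /negPf ->.
by rewrite scale0r.
Qed.

Definition wedge_prod (t : 'I_m -> L) (l : seq 'I_m) : L :=
  \big[(@wedge K m)/ext_basis K finset.set0]_(s <- l) t s.

Lemma wedge_prod_cons t s l : wedge_prod t (s :: l) = wedge (t s) (wedge_prod t l).
Proof. by rewrite /wedge_prod big_cons. Qed.

Lemma wedge_prod_cat_cons (t : 'I_m -> 'I_m -> K) s l1 l2 :
  let T := fun r => ext_oneform (t r) in
  wedge (T s) (wedge_prod T (l1 ++ l2)) =
  (-1) ^+ size l1 *: wedge_prod T (l1 ++ s :: l2).
Proof.
move=> T; elim: l1 => [|r l IH] /=; first by rewrite scale1r wedge_prod_cons.
rewrite wedge_prod_cons wedge_oneform_anticomm -/(T s) IH.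
by rewrite wedge_prod_cons linearZ/= exprS mulN1r scaleNr.
Qed.

Lemma sorted_enum_set S : sorted ltn [seq val s | s <- enum S].
Proof.
rewrite sorted_map; apply: sorted_filter; first by move=> a b c; apply: ltn_trans.
by rewrite -sorted_map -enumT val_enum_ord iota_ltn_sorted.
Qed.

(** Two strictly increasing lists with the same elements are equal. The first part has length
    [below s S], the exponent of the sign of e_s. *)
Lemma enum_set_split s S :
  enum (S :\ s) =
    [seq x : 'I_m <- enum S | (x < s)%N] ++ [seq x : 'I_m <- enum S | (s < x)%N] /\
  (s \in S -> enum S =
     [seq x : 'I_m <- enum S | (x < s)%N] ++
     s :: [seq x : 'I_m <- enum S | (s < x)%N]).
Proof.
pose lto := relpre (val : 'I_m -> nat) ltn.
have tr : transitive lto by move=> a b c; apply: ltn_trans.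
have irr : irreflexive lto by move=> a; rewrite /lto /= ltnn.
have st (A : {set 'I_m}) : sorted lto (enum A).
  by have := sorted_enum_set A; rewrite sorted_map.
have allP1 : all (lto^~ s) [seq x : 'I_m <- enum S | (x < s)%N] by apply: filter_all.
have allP2 : all (lto s) [seq x : 'I_m <- enum S | (s < x)%N] by apply: filter_all.
split=> [|sS]; apply: (irr_sorted_eq tr irr) => //.
- rewrite sorted_pairwise// pairwise_cat; apply/and3P; split.
  + by apply/allrelP => x y /(allP allP1) xs /(allP allP2); apply: tr.
  + by rewrite -sorted_pairwise//; apply: sorted_filter.
  + by rewrite -sorted_pairwise//; apply: sorted_filter.
- move=> x; rewrite mem_cat !(mem_enum, mem_filter) !inE -andb_orl.
  by rewrite -neq_ltn.
- rewrite sorted_pairwise// pairwise_cat /= allP2; apply/and3P; split.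
  + apply/allrelP => x y /(allP allP1) xs; rewrite inE => /predU1P[->//|].
    by move=> /(allP allP2); apply: tr.
  + by rewrite -sorted_pairwise//; apply: sorted_filter.
  + by rewrite -sorted_pairwise//; apply: sorted_filter.
- move=> x; rewrite mem_cat inE !(mem_enum, mem_filter).
  by rewrite orbCA -andb_orl -neq_ltn val_eqE; case: eqVneq => [->|_] //=; rewrite ?sS.
Qed.

Lemma size_below s S : size [seq x : 'I_m <- enum S | (x < s)%N] = below s S.
Proof.
rewrite /below cardE; congr size; rewrite {2}/enum_mem.
by rewrite /enum_mem -filter_predI; apply: eq_filter => x; rewrite !inE andbC.
Qed.

Lemma wedge_gen_basis s S :
  wedge (gen s) (ext_basis K S) =
  if s \in S then 0 else (-1) ^+ below s S *: ext_basis K (s |: S).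
Proof.
apply/ffunP => T; rewrite wedge_genE !ffunE; case: ifPn => sT; last first.
  case: ifPn => sS; rewrite !ffunE //; case: eqP => [e|_]; last by rewrite [RHS]mulr0.
  by move: sT; rewrite e !inE eqxx.
case: ifPn => sS; rewrite !ffunE.
  case: eqP => [e|_]; last by rewrite mulr0.
  by move: sS; rewrite -e !inE eqxx.
have [->|TS] := eqVneq T (s |: S).
  by rewrite finset.setU1K// eqxx /below; congr (_ * _); congr (_ ^+ _);
    apply: fintype.eq_card => x; rewrite !inE; case: eqP => // ->; rewrite ltnn !andbF.
rewrite [RHS]mulr0; case: eqP => [e|_]; last by rewrite mulr0.
by move: TS; rewrite -e finset.setD1K// eqxx.
Qed.

Lemma ext_subst_basis (t : 'I_m -> L) S :
  ext_subst t (ext_basis K S) = wedge_prod t (enum S).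
Proof.
rewrite /ext_subst (bigD1 S)//= ffunE eqxx scale1r big1 ?addr0// => T /negPf TS.
by rewrite ffunE TS scale0r.
Qed.

Lemma wedge_prod_mem (t : 'I_m -> 'I_m -> K) s (l : seq 'I_m) :
  let T := fun r => ext_oneform (t r) in
  s \in l -> wedge (T s) (wedge_prod T l) = 0.
Proof.
move=> T; elim: l => // r l IH; rewrite inE wedge_prod_cons.
case: eqVneq => [<- _|_ /= sl]; first exact: wedge_oneform_alt.
by rewrite wedge_oneform_anticomm IH// linear0 oppr0.
Qed.

(** Multiplicativity of the substitution, checked on e_S. If s is in S, both sides vanish because
    one-forms alternate; otherwise moving T_s past the factors of smaller index gives the same sign
    as moving e_s. *)
Lemma ext_subst_wedge_gen (t : 'I_m -> 'I_m -> K) s u :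
  let T := fun r => ext_oneform (t r) in
  ext_subst T (wedge (gen s) u) = wedge (T s) (ext_subst T u).
Proof.
move=> T; rewrite {1}[u]ext_basis_sum !linear_sum; apply: eq_bigr => S _.
rewrite !linearZ/=; congr (_ *: _).
rewrite wedge_gen_basis -/(wedge_prod T (enum S)).
case: ifPn => sS; first by rewrite linear0 wedge_prod_mem// mem_enum.
have [] := enum_set_split s (s |: S); rewrite finset.setU1K// => e1 e2.
rewrite linearZ/= ext_subst_basis e2 ?inE ?eqxx// e1.
rewrite wedge_prod_cat_cons size_below; congr (_ ^+ _ *: _).
by apply: fintype.eq_card => x; rewrite !inE; case: eqP => // ->; rewrite ltnn !andbF.
Qed.

Lemma ext_subst1 (t : 'I_m -> L) :
  ext_subst t (ext_basis K finset.set0) = ext_basis K finset.set0.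
Proof. by rewrite ext_subst_basis enum_set0 /wedge_prod big_nil. Qed.

(** The algebra is spanned by iterated left multiplications of 1 by generators. Operators whose
    effect on such a multiplication is known can thus be compared by induction. *)
Lemma ext_ind (P : L -> Prop) : P (ext_basis K finset.set0) ->
  (forall s u, P u -> P (wedge (gen s) u)) ->
  (forall a u v, P u -> P v -> P (a *: u + v)) -> forall u, P u.
Proof.
move=> P0 PE PD u.
have PZ0 : P 0.
  by have := PD (-1) _ _ P0 P0; rewrite scaleN1r addNr.
have PZ a v : P v -> P (a *: v) by move=> Pv; rewrite -[_ *: _]addr0; apply: PD.
have PS k S : #|S| = k -> P (ext_basis K S).
  elim: k S => [|k IH] S Sk; first by rewrite (cards0_eq Sk).
  have /set0Pn[s sS] : S != finset.set0 by rewrite -card_gt0 Sk.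
  have Sk' : #|S :\ s| = k by move: Sk; rewrite (cardsD1 s) sS => -[].
  (* Left multiplication of the smaller monomial by e_s yields e_S up to this sign, which therefore
     cancels it. *)
  have := PZ ((-1) ^+ below s (S :\ s)) _ (PE s _ (IH _ Sk')).
  rewrite wedge_gen_basis !inE eqxx /= finset.setD1K// scalerA -exprD addnn.
  by rewrite -mul2n exprM sqrrN expr1n expr1n scale1r.
rewrite [u]ext_basis_sum; elim/big_rec: _ => // S v _ Pv.
by apply: PD Pv; apply: PS.
Qed.
End Exterior.

(** * Differential forms on open subsets of C^n *)

Section LocalOperators.
Local Opaque wirt.
Context (R : realType) (n : nat).
Local Notation C := (R[i]).
Local Notation V := ('rV[R]_(n + n)).
Local Notation I := ('I_(n + n)).
Local Notation L := (ext_alg C (n + n)).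
Local Notation gen := (ext_gen C).
Implicit Types (u v : V -> L) (s r : I) (z : V) (P Q : pred I).

Definition ext_smooth (W : set V) (w : V -> L) :=
  forall S, smooth W (fun z => w z S).

Definition ext_cderivable (w : V -> L) z := forall S, cderivable (fun y => w y S) z.

Definition ext_wirt s (w : V -> L) z : L := [ffun S => wirt s (fun y => w y S) z].

Lemma ext_wirtE s w z S : ext_wirt s w z S = wirt s (fun y => w y S) z.
Proof. by rewrite ffunE. Qed.
Local Opaque ext_wirt.

Lemma ext_smooth_cderivable W w z : ext_smooth W w -> W z -> ext_cderivable w z.
Proof. by move=> hw Wz S; exact: smooth_cderivable (hw S) Wz. Qed.

Lemma ext_smooth_wirt s W w : open W -> ext_smooth W w -> ext_smooth W (ext_wirt s w).
Proof.
move=> oW hw S; apply: (smooth_ext oW _ (smooth_wirt s oW (hw S))) => z _.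
by rewrite ext_wirtE.
Qed.

(* The part of d along the generators in P: d itself for [xpredT], del for [holo]
   and delbar for [antiholo] below. *)
Definition partial_d P (w : V -> L) z : L :=
  \sum_(s | P s) wedge (gen s) (ext_wirt s w z).

Lemma local_dE w z : local_d w z = partial_d xpredT w z.
Proof.
rewrite /local_d /partial_d.
under eq_bigr do rewrite differentialE wedge_suml.
rewrite exchange_big; apply: eq_bigr => s _ /=.
rewrite [ext_wirt s w z]ext_basis_sum linear_sum; apply: eq_bigr => S _.
by rewrite wedgeZl linearZ/= ext_wirtE.
Qed.

Lemma ext_cderivable_sum (J : Type) (l : seq J) (P : pred J) (F : J -> V -> L) z :
  (forall j, ext_cderivable (F j) z) ->
  ext_cderivable (fun y => \sum_(j <- l | P j) F j y) z.
Proof.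
move=> dF S.
have -> : (fun y => (\sum_(j <- l | P j) F j y) S) =
    (fun y => \sum_(j <- l | P j) F j y S).
  by apply: funext => y; rewrite sum_ffunE.
by apply: cderivable_sum => j; apply: dF.
Qed.

Lemma ext_wirt_sum s (J : Type) (l : seq J) (P : pred J) (F : J -> V -> L) z :
  (forall j, ext_cderivable (F j) z) ->
  ext_wirt s (fun y => \sum_(j <- l | P j) F j y) z
  = \sum_(j <- l | P j) ext_wirt s (F j) z.
Proof.
move=> dF; apply/ffunP => S; rewrite ext_wirtE sum_ffunE.
under [RHS]eq_bigr do rewrite ext_wirtE.
rewrite -(wirt_sum s l P (fun j => dF j S)); congr (wirt s _ z).
by apply: funext => y; rewrite sum_ffunE.
Qed.

Lemma ext_cderivableZ (h : V -> C) w z : cderivable h z -> ext_cderivable w z ->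
  ext_cderivable (fun y => h y *: w y) z.
Proof.
move=> dh dw S.
have -> : (fun y => (h y *: w y) S) = (fun y => h y * w y S).
  by apply: funext => y; rewrite ffunE.
exact: cderivableM dh (dw S).
Qed.

Lemma ext_wirtZ s (h : V -> C) w z : cderivable h z -> ext_cderivable w z ->
  ext_wirt s (fun y => h y *: w y) z = wirt s h z *: w z + h z *: ext_wirt s w z.
Proof.
move=> dh dw; apply/ffunP => S; rewrite ext_wirtE.
rewrite [RHS]ffunE [X in _ + X]ffunE [X in X + _]ffunE ext_wirtE.
have -> : (fun y => (h y *: w y) S) = (fun y => h y * w y S).
  by apply: funext => y; rewrite ffunE.
by rewrite (wirtM s dh (dw S)).
Qed.

Lemma wedge_gen_fun r (w : V -> L) S : (fun y => wedge (gen r) (w y) S) =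
  (fun y => (if r \in S then (-1) ^+ below r S else 0) * w y (S :\ r)%SET).
Proof.
by apply: funext => y; rewrite wedge_genE; case: ifP => _; rewrite ?mul0r.
Qed.

Lemma ext_cderivable_wedge_gen r w z : ext_cderivable w z ->
  ext_cderivable (fun y => wedge (gen r) (w y)) z.
Proof.
move=> dw S; rewrite wedge_gen_fun.
exact: cderivableM (cderivable_cst _ _) (dw _).
Qed.

Lemma ext_wirt_wedge_gen s r w z : ext_cderivable w z ->
  ext_wirt s (fun y => wedge (gen r) (w y)) z = wedge (gen r) (ext_wirt s w z).
Proof.
move=> dw; apply/ffunP => S; rewrite ext_wirtE wedge_gen_fun (wirtZ s _ (dw _)).
by rewrite wedge_genE ext_wirtE; case: ifP; rewrite ?mul0r.
Qed.

Lemma ext_wirt_comm W s r w z : open W -> W z -> ext_smooth W w ->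
  ext_wirt s (ext_wirt r w) z = ext_wirt r (ext_wirt s w) z.
Proof.
move=> oW Wz hw; apply/ffunP => S.
have E s' r' : ext_wirt s' (ext_wirt r' w) z S = wirt s' (wirt r' (fun y => w y S)) z.
  rewrite ext_wirtE; congr (wirt s' _ z); apply: funext => y.
  exact: ext_wirtE.
exact: etrans (E s r) (etrans (wirt_comm s r oW Wz (hw S)) (esym (E r s))).
Qed.

(** The generators have constant coefficients, so the second derivation passes through them to the
    coefficients of w. *)
Lemma partial_d2E W P Q w z : open W -> W z -> ext_smooth W w ->
  partial_d P (partial_d Q w) z = \sum_(s | P s) \sum_(r | Q r)
    wedge (gen s) (wedge (gen r) (ext_wirt s (ext_wirt r w) z)).
Proof.
move=> oW Wz hw; apply: eq_bigr => s _; rewrite -linear_sum; congr wedge.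
have dw r : ext_cderivable (ext_wirt r w) z.
  exact: ext_smooth_cderivable (ext_smooth_wirt r oW hw) Wz.
rewrite (ext_wirt_sum s _ _ (fun r => ext_cderivable_wedge_gen r (dw r))).
by apply: eq_bigr => r _; rewrite (ext_wirt_wedge_gen s r (dw r)).
Qed.

Lemma partial_d_anticomm W P Q w z : open W -> W z -> ext_smooth W w ->
  partial_d P (partial_d Q w) z = - partial_d Q (partial_d P w) z.
Proof.
move=> oW Wz hw; rewrite !(partial_d2E _ _ oW Wz hw).
by apply: sym_wedge_gen_swap => s r; exact: ext_wirt_comm oW Wz hw.
Qed.

Lemma partial_d_sum P (J : Type) (l : seq J) (PJ : pred J) (F : J -> V -> L) z :
  (forall j, ext_cderivable (F j) z) ->
  partial_d P (fun y => \sum_(j <- l | PJ j) F j y) z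
  = \sum_(j <- l | PJ j) partial_d P (F j) z.
Proof.
move=> dF; rewrite /partial_d exchange_big; apply: eq_bigr => s _ /=.
by rewrite (ext_wirt_sum s l PJ dF) linear_sum.
Qed.

Definition cgrad (h : V -> C) z s : C := wirt s h z.

Lemma differential_oneform (h : V -> C) z : differential h z = ext_oneform (cgrad h z).
Proof. exact: differentialE. Qed.

Lemma partial_dZ (h : V -> C) w z : cderivable h z -> ext_cderivable w z ->
  partial_d xpredT (fun y => h y *: w y) z =
  wedge (differential h z) (w z) + h z *: partial_d xpredT w z.
Proof.
move=> dh dw; rewrite differential_oneform wedge_oneformE scaler_sumr -big_split.
apply: eq_bigr => s _ /=.
by rewrite (ext_wirtZ s dh dw) linearD !linearZ.
Qed.

Lemma ext_cderivable_wedge_differential W (g : V -> C) w z : open W -> W z ->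
  smooth W g -> ext_cderivable w z ->
  ext_cderivable (fun y => wedge (differential g y) (w y)) z.
Proof.
move=> oW Wz hg dw.
have -> : (fun y => wedge (differential g y) (w y)) =
    (fun y => \sum_r wirt r g y *: wedge (gen r) (w y)).
  by apply: funext => y; rewrite differential_oneform wedge_oneformE.
apply: ext_cderivable_sum => r; apply: ext_cderivableZ.
  exact: smooth_cderivable (smooth_wirt r oW hg) Wz.
exact: ext_cderivable_wedge_gen.
Qed.

(** By the product rule there are terms with second derivatives of g, which cancel by symmetry, and
    terms in which e_s has to pass e_r, which produce the sign. *)
Lemma d_wedge_differential W (g : V -> C) w z : open W -> W z ->
  smooth W g -> ext_cderivable w z ->
  partial_d xpredT (fun y => wedge (differential g y) (w y)) z =
  - wedge (differential g z) (partial_d xpredT w z).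
Proof.
move=> oW Wz hg dw.
have dg r : cderivable (wirt r g) z.
  exact: smooth_cderivable (smooth_wirt r oW hg) Wz.
have dE r := ext_cderivable_wedge_gen r dw.
have -> : (fun y => wedge (differential g y) (w y)) =
    (fun y => \sum_r wirt r g y *: wedge (gen r) (w y)).
  by apply: funext => y; rewrite differential_oneform wedge_oneformE.
have -> : partial_d xpredT (fun y => \sum_r wirt r g y *: wedge (gen r) (w y)) z =
    \sum_s \sum_r wedge (gen s) (wedge (gen r) (wirt s (wirt r g) z *: w z)) +
    \sum_s \sum_r wirt r g z *: wedge (gen s) (wedge (gen r) (ext_wirt s w z)).
  rewrite -big_split; apply: eq_bigr => s _ /=; rewrite -big_split /=.
  rewrite (ext_wirt_sum s _ _ (fun r => ext_cderivableZ (dg r) (dE r))) linear_sum.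
  apply: eq_bigr => r _ /=; rewrite (ext_wirtZ s (dg r) (dE r)) linearD !linearZ/=.
  by rewrite (ext_wirt_wedge_gen s r dw).
rewrite [X in X + _](_ : _ = 0) ?add0r; last first.
  have FC s r : wirt s (wirt r g) z *: w z = wirt r (wirt s g) z *: w z.
    by rewrite (wirt_comm s r oW Wz hg).
  exact: ext_eqN0 (sym_wedge_gen_swap xpredT xpredT FC).
rewrite differential_oneform wedge_oneformE exchange_big -sumrN.
apply: eq_bigr => r _ /=; rewrite linear_sum -scalerN -sumrN scaler_sumr.
by apply: eq_bigr => s _; rewrite wedge_gen_anticomm.
Qed.

Definition pull_frame (f : V -> V) z s : L := differential (fun y => ccoord s (f y)) z.

Lemma pullbackE f w z : pullback f w z = ext_subst (pull_frame f z) (w (f z)).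
Proof.
rewrite /pullback; congr ext_subst; apply: funext => s.
by rewrite /pull_frame /ccoord; case: (fintype.split s).
Qed.

Definition map_smooth (W : set V) (f : V -> V) :=
  forall s, smooth W (fun y => ccoord s (f y)).

(** Pulled-back monomials are products of differentials, so [d_wedge_differential] applies
    repeatedly. Derivability is proved along with closedness because the induction step
    differentiates the shorter product. *)
Lemma pull_frame_prod_closed W f (l : seq I) z : open W -> W z -> map_smooth W f ->
  ext_cderivable (fun y => wedge_prod (pull_frame f y) l) z /\
  partial_d xpredT (fun y => wedge_prod (pull_frame f y) l) z = 0.
Proof.
move=> oW Wz hf; elim: l => [|s l [dl cl]].
  have -> : (fun y => wedge_prod (pull_frame f y) [::]) = (fun=> ext_basis C finset.set0).
    by apply: funext => y; rewrite /wedge_prod big_nil.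
  split=> [S|]; first exact: cderivable_cst.
  rewrite /partial_d big1// => s _; rewrite (_ : ext_wirt _ _ _ = 0) ?linear0//.
  by apply/ffunP => S; rewrite ext_wirtE wirt_cst [RHS]ffunE.
have -> : (fun y => wedge_prod (pull_frame f y) (s :: l)) =
   (fun y => wedge (differential (fun y => ccoord s (f y)) y)
                   (wedge_prod (pull_frame f y) l)).
  by apply: funext => y; rewrite wedge_prod_cons.
split; first exact: ext_cderivable_wedge_differential oW Wz (hf s) dl.
by rewrite (d_wedge_differential oW Wz (hf s) dl) cl linear0 oppr0.
Qed.

Lemma map_smooth_real_derivable W f z : W z -> map_smooth W f -> real_derivable f z.
Proof.
move=> Wz hf r s; case: (split_ordP r) => a ->.
  have [+ _] := smooth_cderivable (hf (lshift n a)) Wz s.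
  by rewrite /ccoord split_lshift.
have [_ +] := smooth_cderivable (hf (lshift n a)) Wz s.
by rewrite /ccoord split_lshift.
Qed.

Lemma differential_comp W (h : V -> C) f z : open W -> W (f z) -> smooth W h ->
  real_derivable f z ->
  differential (fun y => h (f y)) z = \sum_r wirt r h (f z) *: pull_frame f z r.
Proof.
move=> oW Wz hh df; rewrite differentialE.
under eq_bigr => s _ do rewrite (wirt_comp s oW Wz hh df) scaler_suml.
rewrite exchange_big; apply: eq_bigr => r _ /=.
rewrite /pull_frame differentialE scaler_sumr; apply: eq_bigr => s _.
by rewrite scalerA.
Qed.

(** Both sides equal the sum over S of the differential of w_S o f wedged with the pullback of e_S:
    on the left because these pullbacks are closed, on the right by multiplicativity of the
    substitution and the chain rule. *)
Lemma local_d_pullback W W' f w z : open W -> W z -> map_smooth W f ->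
  open W' -> W' (f z) -> ext_smooth W' w ->
  local_d (pullback f w) z = pullback f (local_d w) z.
Proof.
move=> oW Wz hf oW' Wz' hw; rewrite local_dE.
have df := map_smooth_real_derivable Wz hf.
have dw S : cderivable (fun y => w (f y) S) z by exact: cderivable_comp oW' Wz' (hw S) df.
have dP (S : {set I}) := (pull_frame_prod_closed (enum S) oW Wz hf).1.
have cP (S : {set I}) := (pull_frame_prod_closed (enum S) oW Wz hf).2.
have -> : pullback f w =
    (fun y => \sum_S w (f y) S *: wedge_prod (pull_frame f y) (enum S)).
  by apply: funext => y; rewrite pullbackE.
rewrite (partial_d_sum _ _ _ (fun S => ext_cderivableZ (dw S) (dP S))).
rewrite pullbackE local_dE linear_sum.
have E r : ext_subst (pull_frame f z) (wedge (gen r) (ext_wirt r w (f z))) =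
    wedge (pull_frame f z r) (ext_subst (pull_frame f z) (ext_wirt r w (f z))).
  have -> : pull_frame f z = (fun s => ext_oneform (cgrad (fun y => ccoord s (f y)) z)).
    by apply: funext => s; rewrite /pull_frame differential_oneform.
  exact: ext_subst_wedge_gen.
rewrite (eq_bigr _ (fun r _ => E r)).
under [RHS]eq_bigr => r _ do rewrite linear_sum.
rewrite [RHS]exchange_big; apply: eq_bigr => S _ /=.
rewrite (partial_dZ (dw S) (dP S)) cP scaler0 addr0.
rewrite (differential_comp oW' Wz' (hw S) df) wedge_suml; apply: eq_bigr => r _.
by rewrite wedgeZl linearZ/= ext_wirtE.
Qed.
End LocalOperators.

(** * Bidegrees and the splitting of d *)

Section Bidegree.
Context (R : realType) (n : nat).
Local Opaque wirt ext_wirt.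
Local Notation C := (R[i]).
Local Notation V := ('rV[R]_(n + n)).
Local Notation I := ('I_(n + n)).
Local Notation L := (ext_alg C (n + n)).
Local Notation gen := (ext_gen C).
Implicit Types (u v : L) (w : V -> L) (s r : I) (z : V) (P Q : pred I).

Definition holo s := if fintype.split s is inl _ then true else false.
Definition antiholo s := ~~ holo s.

Lemma holo_lshift (a : 'I_n) : holo (lshift n a) = true.
Proof. by rewrite /holo split_lshift. Qed.

Lemma holo_rshift (a : 'I_n) : holo (rshift n a) = false.
Proof. by rewrite /holo split_rshift. Qed.

Lemma holo_cswap s : holo (cswap s) = ~~ holo s.
Proof.
by case: (split_ordP s) => a ->;
  rewrite ?cswap_lshift ?cswap_rshift holo_lshift holo_rshift.
Qed.

Lemma local_d_split w z :
  local_d w z = partial_d holo w z + partial_d antiholo w z.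
Proof. by rewrite local_dE /partial_d (bigID holo). Qed.

Lemma bidegree_lshift (a : 'I_n) (S : {set I}) : lshift n a \in S ->
  let T := (S :\ lshift n a)%SET in
  bidegree S = ((bidegree T).1.+1, (bidegree T).2).
Proof.
move=> aS; rewrite /bidegree /=; congr (_, _).
  rewrite (cardsD1 a) inE aS add1n; congr _.+1; apply: fintype.eq_card => b.
  by rewrite !inE (inj_eq (@lshift_inj n n)).
by apply: fintype.eq_card => b; rewrite !inE eq_rlshift.
Qed.

Lemma bidegree_rshift (a : 'I_n) (S : {set I}) : rshift n a \in S ->
  let T := (S :\ rshift n a)%SET in
  bidegree S = ((bidegree T).1, (bidegree T).2.+1).
Proof.
move=> aS; rewrite /bidegree /=; congr (_, _).
  by apply: fintype.eq_card => b; rewrite !inE eq_lrshift.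
rewrite (cardsD1 a) inE aS add1n; congr _.+1; apply: fintype.eq_card => b.
by rewrite !inE (inj_eq (@rshift_inj n n)).
Qed.

Lemma eq_bidegree_lshift (a : 'I_n) (S : {set I}) p q : lshift n a \in S ->
  (bidegree S == (p, q)) =
  if p is p'.+1 then bidegree (S :\ lshift n a)%SET == (p', q) else false.
Proof.
move=> /bidegree_lshift ->; case: (bidegree _) => x y.
by case: p => [|p]; rewrite !xpair_eqE.
Qed.

Lemma eq_bidegree_rshift (a : 'I_n) (S : {set I}) p q : rshift n a \in S ->
  (bidegree S == (p, q)) =
  if q is q'.+1 then bidegree (S :\ rshift n a)%SET == (p, q') else false.
Proof.
move=> /bidegree_rshift ->; case: (bidegree _) => x y.
by case: q => [|q]; rewrite !xpair_eqE ?andbF.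
Qed.

Lemma bidegree_card (S : {set I}) : ((bidegree S).1 + (bidegree S).2 = #|S|)%N.
Proof.
rewrite /bidegree /= -(card_imset _ (@lshift_inj n n)) -(card_imset _ (@rshift_inj n n)).
rewrite -cardsUI [X in (_ + #|pred_of_set X|)%N](_ : _ = finset.set0) ?cards0 ?addn0.
  apply: fintype.eq_card => s; rewrite inE; case: (split_ordP s) => a ->.
    rewrite mem_imset ?inE; last exact: lshift_inj.
    by apply/orb_idr => /imsetP[b _ /eqP]; rewrite eq_lrshift.
  rewrite orbC mem_imset ?inE; last exact: rshift_inj.
  by apply/orb_idr => /imsetP[b _ /eqP]; rewrite eq_rlshift.
apply/setP => s; rewrite !inE; apply/negP => /andP[/imsetP[b _ ->]] /imsetP[c _ /eqP].
by rewrite eq_lrshift.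
Qed.

Lemma bidegree0 : bidegree (finset.set0 : {set I}) = (0, 0)%N.
Proof. by rewrite /bidegree; congr (_, _); apply: eq_card0 => x; rewrite !inE. Qed.

Lemma component_linear p q : linear (@component R n p q : L -> L).
Proof. by move=> a u v; exact: componentP. Qed.
HB.instance Definition _ p q := GRing.isLinear.Build C L L _ (@component R n p q : L -> L)
  (component_linear p q).

Lemma component_wedge_lshift p q (a : 'I_n) u :
  component p q (wedge (gen (lshift n a)) u) =
  if p is p'.+1 then wedge (gen (lshift n a)) (component p' q u) else 0.
Proof.
apply/ffunP => S; rewrite [LHS]ffunE wedge_genE.
case: p => [|p]; [rewrite [RHS]ffunE|rewrite wedge_genE];
  case: (boolP (_ \in S)) => aS; rewrite ?if_same// (eq_bidegree_lshift _ _ aS)//.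
by rewrite [in RHS]ffunE; case: ifP; rewrite ?mulr0.
Qed.

Lemma component_wedge_rshift p q (a : 'I_n) u :
  component p q (wedge (gen (rshift n a)) u) =
  if q is q'.+1 then wedge (gen (rshift n a)) (component p q' u) else 0.
Proof.
apply/ffunP => S; rewrite [LHS]ffunE wedge_genE.
case: q => [|q]; [rewrite [RHS]ffunE|rewrite wedge_genE];
  case: (boolP (_ \in S)) => aS; rewrite ?if_same// (eq_bidegree_rshift _ _ aS)//.
by rewrite [in RHS]ffunE; case: ifP; rewrite ?mulr0.
Qed.

Lemma ext_wirt_component p q s w z :
  ext_wirt s (fun y => component p q (w y)) z = component p q (ext_wirt s w z).
Proof.
apply/ffunP => S; rewrite ext_wirtE [RHS]ffunE ext_wirtE.
case: ifP => pq; first by congr (wirt s _ z); apply: funext => y; rewrite ffunE pq.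
rewrite -[RHS](wirt_cst s 0 z); congr (wirt s _ z).
by apply: funext => y; rewrite ffunE pq.
Qed.

Lemma component_partial_holo p q w z : component p q (partial_d holo w z) =
  if p is p'.+1 then partial_d holo (fun y => component p' q (w y)) z else 0.
Proof.
rewrite linear_sum /=; case: p => [|p]; [apply: big1|apply: eq_bigr] => s;
  case: (split_ordP s) => a ->; rewrite ?holo_rshift// => _.
  by rewrite component_wedge_lshift.
by rewrite component_wedge_lshift ext_wirt_component.
Qed.

Lemma component_partial_antiholo p q w z : component p q (partial_d antiholo w z) =
  if q is q'.+1 then partial_d antiholo (fun y => component p q' (w y)) z else 0.
Proof.
rewrite linear_sum /=; case: q => [|q]; [apply: big1|apply: eq_bigr] => s;
  case: (split_ordP s) => a ->; rewrite /antiholo ?holo_lshift// => _.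
  by rewrite component_wedge_rshift.
by rewrite component_wedge_rshift ext_wirt_component.
Qed.

(** The hypothesis makes the substitution block diagonal: each dz_a goes to a combination of the
    dz_b and each d\bar z_a to one of the d\bar z_b, so a left multiplication shifts the bidegree
    alike before and after. *)
Lemma component_ext_subst (t : I -> I -> C) p q u :
  (forall s r, holo s != holo r -> t s r = 0) ->
  let T := fun s => ext_oneform (t s) in
  component p q (ext_subst T u) = ext_subst T (component p q u).
Proof.
move=> t0 T; move: p q; elim/ext_ind: u => [|s u IH|a u v IHu IHv] p q.
- have e : component p q (ext_basis C finset.set0) =
      (((0%N, 0%N) == (p, q))%:R : C) *: ext_basis C finset.set0 :> L.
    apply/ffunP => S; rewrite !ffunE; case: (S =P finset.set0) => [->|_].
      by rewrite bidegree0 [RHS]mulr1; case: ifP.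
    by rewrite if_same [RHS]mulr0.
  by rewrite ext_subst1 e linearZ/= ext_subst1.
- rewrite ext_subst_wedge_gen -/T wedge_oneformE linear_sum /=.
  case: (split_ordP s) => a sa.
    have E (r : I) : component p q (t s r *: wedge (gen r) (ext_subst T u)) =
        t s r *: (if p is p'.+1 then
          wedge (gen r) (component p' q (ext_subst T u)) else 0).
      rewrite linearZ/=; case: (split_ordP r) => b rb.
        by rewrite rb component_wedge_lshift.
      by rewrite t0 ?scale0r// sa rb holo_lshift holo_rshift.
    rewrite (eq_bigr _ (fun r _ => E r)) [in RHS]sa component_wedge_lshift -sa.
    case: p {E} => [|p]; first by rewrite linear0 big1// => r _; rewrite scaler0.
    by rewrite IH ext_subst_wedge_gen -/T wedge_oneformE.
  have E (r : I) : component p q (t s r *: wedge (gen r) (ext_subst T u)) =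
      t s r *: (if q is q'.+1 then
        wedge (gen r) (component p q' (ext_subst T u)) else 0).
    rewrite linearZ/=; case: (split_ordP r) => b rb.
      by rewrite t0 ?scale0r// sa rb holo_lshift holo_rshift.
    by rewrite rb component_wedge_rshift.
  rewrite (eq_bigr _ (fun r _ => E r)) [in RHS]sa component_wedge_rshift -sa.
  case: q {E} => [|q]; first by rewrite linear0 big1// => r _; rewrite scaler0.
  by rewrite IH ext_subst_wedge_gen -/T wedge_oneformE.
- by rewrite ext_substP !componentP ext_substP IHu IHv.
Qed.

Lemma holomorphic_map_smooth (W : set V) (f : V -> V) :
  open W -> holomorphic W f -> map_smooth W f.
Proof.
move=> oW hf s; rewrite /ccoord; case: (fintype.split s) => a.
  exact: (hf a).1.
move=> k; have [f1 f2] := (hf a).1 k; split.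
  by apply: class_C_ext f1.
by apply: class_C_ext (class_C_lin (-1) 0 oW f2 f2) => // y _; rewrite mul0r addr0 mulN1r.
Qed.

(** The off-diagonal blocks of the frame vanish by the Cauchy-Riemann equations and, for the
    conjugate coordinates, by their conjugates. *)
Lemma component_pullback (W : set V) (f : V -> V) w p q z :
  open W -> W z -> holomorphic W f ->
  component p q (pullback f w z) = pullback f (fun y => component p q (w y)) z.
Proof.
move=> oW Wz hf; rewrite !pullbackE.
have -> : pull_frame f z = (fun s => ext_oneform (cgrad (fun y => ccoord s (f y)) z)).
  by apply: funext => s; rewrite /pull_frame differential_oneform.
apply: component_ext_subst => s r; rewrite /cgrad /ccoord.
case: (split_ordP s) => a ->; case: (split_ordP r) => b ->;
  rewrite ?split_lshift ?split_rshift ?holo_lshift ?holo_rshift// => _.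
  by rewrite wirt_rshift (hf a).2.
rewrite wirt_conj ?cswap_lshift ?wirt_rshift ?(hf a).2 ?conjc0//.
exact: smooth_cderivable (hf a).1 Wz.
Qed.
End Bidegree.

(** * Complex conjugation of local forms *)

Section Conjugation.
Context (R : realType) (n : nat).
Local Opaque wirt ext_wirt.
Local Notation C := (R[i]).
Local Notation V := ('rV[R]_(n + n)).
Local Notation I := ('I_(n + n)).
Local Notation L := (ext_alg C (n + n)).
Local Notation gen := (ext_gen C).
Local Notation conj := (@conj_ext R n).
Implicit Types (u v : L) (w : V -> L) (s r : I) (z : V) (P Q : pred I).

Lemma smooth_conj W (f : V -> C) : open W -> smooth W f ->
  smooth W (fun y => (f y)^*%C).
Proof.
move=> oW hf k; have [f1 f2] := hf k; split.
  apply: class_C_ext f1 => // y _; by case: (f y).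
apply: class_C_ext (class_C_lin (-1) 0 oW f2 f2) => // y _.
by rewrite mul0r addr0 mulN1r; case: (f y).
Qed.

Lemma conj_extE u : conj u =
  \sum_(S : {set I}) (u S)^*%C *: wedge_prod (fun s => gen (cswap s)) (enum S).
Proof.
rewrite /conj_ext /ext_subst; apply: eq_bigr => S _; rewrite ffunE.
by congr (_ *: \big[_/_]_(_ <- _) _); apply: funext => s; rewrite /cswap.
Qed.

Lemma componentE p q u S : component p q u S = if bidegree S == (p, q) then u S else 0.
Proof. by rewrite ffunE. Qed.

(** Written with one-forms, conjugation falls under the multiplicativity lemma
    [ext_subst_wedge_gen]. *)
Lemma conj_ext_subst u : conj u =
  ext_subst (fun s => ext_oneform (fun r => (r == cswap s)%:R)) [ffun S => (u S)^*%C].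
Proof.
rewrite /conj_ext; congr ext_subst; apply: funext => s.
by rewrite -ext_gen_oneform.
Qed.

Lemma conj_extP (a : C) u v : conj (a *: u + v) = a^*%C *: conj u + conj v.
Proof.
rewrite !conj_extE scaler_sumr -big_split; apply: eq_bigr => S _ /=.
by rewrite !ffunE conjcD conjcM scalerDl scalerA.
Qed.

Local Opaque conj_ext component ext_subst.

Lemma conj_ext0 : conj 0 = 0.
Proof.
by rewrite conj_extE big1// => S _; rewrite ffunE conjc0 scale0r.
Qed.

Lemma conj_extD u v : conj (u + v) = conj u + conj v.
Proof. by rewrite -[u]scale1r conj_extP conjc1 !scale1r. Qed.

Lemma conj_extZ (a : C) u : conj (a *: u) = a^*%C *: conj u.
Proof. by rewrite -[a *: u]addr0 conj_extP conj_ext0 addr0. Qed.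

Lemma conj_ext_sum (J : Type) (l : seq J) (PJ : pred J) (F : J -> L) :
  conj (\sum_(j <- l | PJ j) F j) = \sum_(j <- l | PJ j) conj (F j).
Proof. exact: (big_morph conj conj_extD conj_ext0). Qed.

Lemma conj_ext1 : conj (ext_basis C finset.set0) = ext_basis C finset.set0.
Proof.
rewrite conj_ext_subst (_ : [ffun _ => _] = ext_basis C finset.set0) ?ext_subst1//.
by apply/ffunP => S; rewrite !ffunE; case: eqP; rewrite ?conjc1 ?conjc0.
Qed.

Lemma conj_ext_wedge_gen s u : conj (wedge (gen s) u) = wedge (gen (cswap s)) (conj u).
Proof.
rewrite !conj_ext_subst (ext_gen_oneform _ (cswap s)).
rewrite -(ext_subst_wedge_gen (fun s r => (r == cswap s)%:R) s); congr ext_subst.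
apply/ffunP => S; rewrite ffunE !wedge_genE; case: ifP; rewrite ?conjc0//.
by rewrite ffunE conjcM [X in X * _]rmorphXn [X in X ^+ _]rmorphN1.
Qed.

Lemma conj_extK : involutive conj.
Proof.
elim/ext_ind => [|s u IH|a u v IHu IHv]; first by rewrite !conj_ext1.
  by rewrite !conj_ext_wedge_gen cswapK IH.
rewrite (conj_extP a u v) (conj_extP a^*%C (conj u) (conj v)) (conjcK a).
exact: (congr2 (fun x y => a *: x + y) IHu IHv).
Qed.

Lemma component_conj p q u : component p q (conj u) = conj (component q p u).
Proof.
move: p q; elim/ext_ind: u => [|s u IH|a u v IHu IHv] p q.
- have e (k l : nat) : component k l (ext_basis C finset.set0) =
      (((0%N, 0%N) == (k, l))%:R : C) *: ext_basis C finset.set0 :> L.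
    apply/ffunP => S; rewrite componentE !ffunE; case: (S =P finset.set0) => [->|_].
      by rewrite bidegree0 [RHS]mulr1; case: ifP.
    by rewrite if_same [RHS]mulr0.
  rewrite conj_ext1 !e conj_extZ conj_ext1; congr (_ *: _).
  by rewrite !xpair_eqE andbC; case: andb; rewrite ?conjc0 ?conjc1.
- rewrite conj_ext_wedge_gen; case: (split_ordP s) => a ->.
    rewrite cswap_lshift component_wedge_rshift component_wedge_lshift.
    case: q => [|q]; first by rewrite conj_ext0.
    by rewrite IH conj_ext_wedge_gen cswap_lshift.
  rewrite cswap_rshift component_wedge_rshift component_wedge_lshift.
  case: p => [|p]; first by rewrite conj_ext0.
  by rewrite IH conj_ext_wedge_gen cswap_rshift.
- rewrite (conj_extP a u v) (componentP p q a^*%C (conj u) (conj v)).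
  rewrite (componentP q p a u v) (conj_extP a (component q p u) (component q p v)).
  exact: (congr2 (fun x y => a^*%C *: x + y) (IHu p q) (IHv p q)).
Qed.

Lemma conj_coefE w T : (fun y => conj (w y) T) =
  (fun y => \sum_(S : {set I})
    wedge_prod (fun s => gen (cswap s)) (enum S) T * (w y S)^*%C).
Proof.
apply: funext => y; rewrite conj_extE sum_ffunE; apply: eq_bigr => S _.
by rewrite [LHS]ffunE; exact: mulrC.
Qed.

Lemma ext_smooth_conj W w : open W -> ext_smooth W w ->
  ext_smooth W (fun y => conj (w y)).
Proof.
move=> oW hw T; rewrite conj_coefE; apply: smooth_sum => // S.
by apply: smoothZ => //; apply: smooth_conj.
Qed.

Lemma ext_wirt_conj s w z : ext_cderivable w z ->
  ext_wirt s (fun y => conj (w y)) z = conj (ext_wirt (cswap s) w z).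
Proof.
move=> dw; apply/ffunP => T; rewrite ext_wirtE conj_coefE.
have dc S := cderivable_conj (dw S).
rewrite (wirt_sum s _ _ (fun S => cderivableM (cderivable_cst _ _) (dc S))).
rewrite conj_extE sum_ffunE; apply: eq_bigr => S _.
rewrite (wirtZ s _ (dc S)) (wirt_conj s (dw S)) [RHS]ffunE ext_wirtE.
exact: mulrC.
Qed.

Lemma partial_d_conj P w z : ext_cderivable w z ->
  partial_d P (fun y => conj (w y)) z = conj (partial_d (fun s => P (cswap s)) w z).
Proof.
move=> dw; rewrite /partial_d conj_ext_sum (reindex_inj (inv_inj (@cswapK n))).
apply: eq_bigr => s _.
by rewrite (ext_wirt_conj _ dw) conj_ext_wedge_gen cswapK.
Qed.

(** The hypothesis says that the conjugate of T_s is T_(cswap s). A pulled-back frame satisfies it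
    because the coordinates of index s and [cswap s] are conjugate functions. *)
Lemma conj_ext_pullback_frame (t : I -> I -> C) u :
  (forall s r, (t s (cswap r))^*%C = t (cswap s) r) ->
  let T := fun s => ext_oneform (t s) in
  conj (ext_subst T u) = ext_subst T (conj u).
Proof.
move=> tC T; have TC s v : conj (wedge (T s) v) = wedge (T (cswap s)) (conj v).
  rewrite !wedge_oneformE conj_ext_sum (reindex_inj (inv_inj (@cswapK n))).
  apply: eq_bigr => r _.
  by rewrite conj_extZ conj_ext_wedge_gen cswapK tC.
elim/ext_ind: u => [|s u IH|a u v IHu IHv].
- by rewrite conj_ext1 ext_subst1 conj_ext1.
- by rewrite ext_subst_wedge_gen TC IH conj_ext_wedge_gen ext_subst_wedge_gen.
- by rewrite ext_substP (conj_extP a) (conj_extP a u v) ext_substP IHu IHv.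
Qed.

Lemma conj_pullback (W : set V) (f : V -> V) w z : open W -> W z -> map_smooth W f ->
  conj (pullback f w z) = pullback f (fun y => conj (w y)) z.
Proof.
move=> oW Wz hf; rewrite !pullbackE.
have -> : pull_frame f z = (fun s => ext_oneform (cgrad (fun y => ccoord s (f y)) z)).
  by apply: funext => s; rewrite /pull_frame differential_oneform.
apply: conj_ext_pullback_frame => s r; rewrite /cgrad.
rewrite -(wirt_conj r (smooth_cderivable (hf s) Wz)).
congr (wirt r _ z); apply: funext => y; rewrite /ccoord.
case: (split_ordP s) => a ->;
  rewrite ?cswap_lshift ?cswap_rshift ?split_lshift ?split_rshift ?conjcK//.
Qed.
End Conjugation.

(** * Differential forms on manifolds *)

Section GlobalOperators.
Context (R : realType) (n : nat) (X : complex_manifold R n).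
Local Opaque wirt ext_wirt.
Local Notation C := (R[i]).
Local Notation V := ('rV[R]_(n + n)).
Local Notation I := ('I_(n + n)).
Local Notation L := (ext_alg C (n + n)).
Local Notation F := (local_forms X).
Implicit Types (u v w : F) (P Q : pred I) (i j : atlas X) (x : X) (z : V).

Lemma lincoefE (a : C) (A B : L) (S : {set I}) : (a *: A + B) S = a * A S + B S.
Proof. by rewrite !ffunE. Qed.

Lemma partial_d_ext P (W : set V) (f g : V -> L) z : open W -> W z ->
  (forall y, W y -> f y = g y) -> partial_d P f z = partial_d P g z.
Proof.
move=> oW Wz fg; apply: eq_bigr => s _; congr wedge; apply/ffunP => S; rewrite !ext_wirtE.
apply: wirt_near; have : nbhs z W by exact: open_nbhs_nbhs.
by apply: filterS => y Wy; rewrite fg.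
Qed.

Lemma open_chart_image i : open (chart_image i).
Proof. exact: (@chart_open _ _ X i). Qed.
Arguments open_chart_image : clear implicits.

Definition overlap i j : set V := chart i @` (domain i `&` domain j).

(** Compatibility of the local expressions is an identity on this set; openness permits
    differentiating it there. *)
Lemma open_overlap i j : open (overlap i j).
Proof.
rewrite openE => _ [x [ix jx] <-].
have n1 : nbhs (chart i x) (chart_image i).
  by apply: open_nbhs_nbhs; split; [exact: open_chart_image | exists x].
have n2 : nbhs (chart i x) (param i @^-1` domain j).
  apply: (@param_continuous _ _ X i (chart i x)); first by exists x.
  rewrite chartK//; apply: open_nbhs_nbhs; split => //; exact: domain_open.
apply: filterS2 n1 n2 => _ [y iy <-] /=.
by rewrite chartK// => jy; exists y.
Qed.

Arguments open_overlap : clear implicits.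

(** Smoothness in the charts without gluing: enough for the operator identities, and visibly
    preserved by each [partial_dform P]. *)
Definition loc_smooth w := forall i, ext_smooth (chart_image i) (w i).

Lemma smooth_form_loc w : smooth_form w -> loc_smooth w.
Proof. by move=> [_ ws _] i S; apply: ws. Qed.

Definition partial_dform P w : F :=
  fun i z => if z \in chart_image i then partial_d P (w i) z else 0.

Lemma dform_split w : dform w = partial_dform (@holo n) w + partial_dform (@antiholo n) w.
Proof.
apply: funext => i; apply: funext => z; rewrite !fctE /dform /partial_dform.
by case: ifP => _; rewrite ?addr0// local_d_split.
Qed.

Lemma overlap_compat w i j : smooth_form w ->
  forall z, overlap i j z -> w i z = pullback (chart j \o param i) (w j) z.
Proof. by move=> [_ _ wc] _ [x [ix jx] <-]; apply: wc. Qed.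

Lemma smooth_form_d w : smooth_form w -> smooth_form (dform w).
Proof.
move=> sw; have [w0 ws wc] := sw; split.
- by move=> i z iz; rewrite /dform memNset.
- move=> i S; have oi := open_chart_image i.
  apply: (smooth_ext oi _ (smooth_local_d S oi (ws i))) => z iz.
  by rewrite /dform mem_set.
- move=> i j x ix jx.
  have Wx : overlap i j (chart i x) by exists x.
  have ci : chart_image i (chart i x) by exists x.
  have cj : chart_image j (chart j x) by exists x.
  have fx : (chart j \o param i) (chart i x) = chart j x by rewrite /= chartK.
  have hf := @transition_holomorphic _ _ X i j.
  have oW := open_overlap i j.
  rewrite /dform mem_set// local_dE.
  rewrite (partial_d_ext _ oW Wx (overlap_compat sw)) -local_dE.
  have mf := holomorphic_map_smooth oW hf.
  rewrite (local_d_pullback oW Wx mf (open_chart_image j) _ (ws j)).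
    by rewrite !pullbackE fx mem_set.
  by rewrite fx.
Qed.

Definition compform p q w : F := fun i z => component p q (w i z).

Lemma compform_loc p q w : loc_smooth w -> loc_smooth (compform p q w).
Proof.
move=> ws i S; have oi := open_chart_image i.
have [pq|pq] := boolP (bidegree S == (p, q)).
  by apply: (smooth_ext oi _ (ws i S)) => z _; rewrite /compform componentE pq.
by apply: (smooth_ext oi _ (smooth0 oi)) => z _; rewrite /compform componentE (negPf pq).
Qed.

Lemma smooth_form_comp p q w : smooth_form w -> smooth_form (compform p q w).
Proof.
move=> sw; have [w0 ws wc] := sw; split.
- by move=> i z iz; rewrite /compform w0// linear0.
- exact: compform_loc (smooth_form_loc sw).
- move=> i j x ix jx.
  have Wx : overlap i j (chart i x) by exists x.
  rewrite /compform (overlap_compat sw Wx).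
  exact: component_pullback (open_overlap i j) Wx (@transition_holomorphic _ _ X i j).
Qed.

Lemma compform_lin p q (a : C) u v :
  compform p q (a *: u + v) = a *: compform p q u + compform p q v.
Proof. by apply: funext => i; apply: funext => z; rewrite /compform !fctE componentP. Qed.

Lemma partial_dform_lin P (a : C) u v : loc_smooth u -> loc_smooth v ->
  partial_dform P (a *: u + v) = a *: partial_dform P u + partial_dform P v.
Proof.
move=> us vs; apply: funext => i; apply: funext => z; rewrite !fctE /partial_dform.
case: ifPn => [|_]; last by rewrite scaler0 addr0.
rewrite inE => iz; rewrite /partial_d scaler_sumr -big_split; apply: eq_bigr => s _ /=.
rewrite -linearP; congr wedge; apply/ffunP => S.
rewrite ext_wirtE lincoefE !ext_wirtE.
have -> : (fun y => (a *: u + v) i y S) = (fun y => a * u i y S + v i y S).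
  by apply: funext => y; exact: lincoefE.
have du := smooth_cderivable (us i S) iz; have dv := smooth_cderivable (vs i S) iz.
by rewrite (wirtD s (cderivableM (cderivable_cst a z) du) dv) (wirtZ s a du).
Qed.

Lemma partial_dform_loc P w : loc_smooth w -> loc_smooth (partial_dform P w).
Proof.
move=> ws i S; have oi := open_chart_image i.
have e1 z : chart_image i z -> partial_d P (w i) z S = partial_dform P w i z S.
  by move=> iz; rewrite /partial_dform mem_set.
apply: (smooth_ext oi e1).
have e2 z : chart_image i z -> \sum_(s | P s)
    ((if s \in S then (-1) ^+ below s S else 0) * ext_wirt s (w i) z (S :\ s)%SET)
    = partial_d P (w i) z S.
  move=> _; rewrite /partial_d sum_ffunE; apply: eq_bigr => s _.
  by rewrite wedge_genE; case: ifP; rewrite ?mul0r.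
apply: (smooth_ext oi e2).
apply: smooth_sum => // s; apply: smoothZ => //.
exact: ext_smooth_wirt.
Qed.

Lemma partial_dform_anticomm P Q w : loc_smooth w ->
  partial_dform P (partial_dform Q w) = - partial_dform Q (partial_dform P w).
Proof.
move=> ws; apply: funext => i; apply: funext => z; rewrite !fctE /partial_dform.
case: ifPn => [|_]; last by rewrite oppr0.
rewrite inE => iz; have oi := open_chart_image i.
have E P' Q' : partial_d P'
    (fun z => if z \in chart_image i then partial_d Q' (w i) z else 0) z
    = partial_d P' (partial_d Q' (w i)) z.
  by apply: (partial_d_ext _ oi iz) => y iy; rewrite mem_set.
by rewrite !E (partial_d_anticomm P Q oi iz (ws i)).
Qed.

Lemma partial_dform_sq P w : loc_smooth w -> partial_dform P (partial_dform P w) = 0.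
Proof.
move=> ws; have e := partial_dform_anticomm P P ws.
apply: funext => i; apply: funext => z; apply: ext_eqN0.
by rewrite {1}e.
Qed.

Lemma compform_del p q w : compform p q (partial_dform (@holo n) w) =
  if p is p'.+1 then partial_dform (@holo n) (compform p' q w) else 0.
Proof.
apply: funext => i; apply: funext => z; rewrite /compform /partial_dform.
case: ifPn => iz.
  by rewrite component_partial_holo; case: p => // p; rewrite /partial_dform iz.
by rewrite linear0; case: p => // p; rewrite /partial_dform (negPf iz).
Qed.

Lemma compform_delbar p q w : compform p q (partial_dform (@antiholo n) w) =
  if q is q'.+1 then partial_dform (@antiholo n) (compform p q' w) else 0.
Proof.
apply: funext => i; apply: funext => z; rewrite /compform /partial_dform.
case: ifPn => iz.
  by rewrite component_partial_antiholo; case: q => // q; rewrite /partial_dform iz.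
by rewrite linear0; case: q => // q; rewrite /partial_dform (negPf iz).
Qed.

Lemma pqformsP p q w : pqforms X p q w <-> smooth_form w /\ compform p q w = w.
Proof.
split=> -[sw hw]; split=> //.
  apply: funext => i; apply: funext => z; apply/ffunP => S.
  by rewrite /compform componentE; case: ifPn => // /hw ->.
by move=> i z S /negPf pq; rewrite -hw /compform componentE pq.
Qed.

Lemma compform_pqforms p q w : smooth_form w -> pqforms X p q (compform p q w).
Proof.
move=> sw; split=> [|i z S /negPf pqS]; first exact: smooth_form_comp.
by rewrite /compform componentE pqS.
Qed.

Lemma compform_pq p q p' q' w : pqforms X p q w -> (p, q) != (p', q') ->
  compform p' q' w = 0.
Proof.
move=> [sw hw] pq; apply: funext => i; apply: funext => z; apply/ffunP => S.
rewrite /compform componentE [RHS]ffunE; case: eqP => // e.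
by apply: hw; rewrite e eq_sym.
Qed.

Lemma partial_dform0 P : partial_dform P 0 = 0.
Proof.
have s0 : loc_smooth (0 : F) by exact: smooth_form_loc (smooth_form0 X).
have := partial_dform_lin P (-1) s0 s0.
by rewrite scaleN1r addNr scaleN1r addNr.
Qed.

(** The gluing condition is obtained through d: for w of type (p, q), del w is the component of type
    (p + 1, q) of d w, because delbar w contributes nothing to it, and both d and components respect
    transition maps. *)
Lemma del_pq p q w : pqforms X p q w ->
  del p q w = partial_dform (@holo n) w /\
  pqforms X p.+1 q (partial_dform (@holo n) w).
Proof.
move=> hw; have [sw cw] := (pqformsP p q w).1 hw.
have e : del p q w = partial_dform (@holo n) w.
  rewrite -[LHS]/(compform p.+1 q (dform w)) dform_split.
  have -> : partial_dform (@holo n) w + partial_dform (@antiholo n) w =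
      1 *: partial_dform (@holo n) w + partial_dform (@antiholo n) w by rewrite scale1r.
  rewrite compform_lin scale1r compform_del compform_delbar cw.
  case: q hw {cw} => [|q] hw; first by rewrite addr0.
  by rewrite (compform_pq hw) ?partial_dform0 ?addr0//
    xpair_eqE negb_and neq_ltn ltnSn.
split=> //; rewrite -e; apply/pqformsP.
rewrite -[del p q w]/(compform p.+1 q (dform w)); split.
  by apply: smooth_form_comp; apply: smooth_form_d.
by rewrite -[compform _ _ (dform w)]/(del p q w) e compform_del cw.
Qed.

Lemma delbar_pq p q w : pqforms X p q w ->
  delbar p q w = partial_dform (@antiholo n) w /\
  pqforms X p q.+1 (partial_dform (@antiholo n) w).
Proof.
move=> hw; have [sw cw] := (pqformsP p q w).1 hw.
have e : delbar p q w = partial_dform (@antiholo n) w.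
  rewrite -[LHS]/(compform p q.+1 (dform w)) dform_split.
  have -> : partial_dform (@holo n) w + partial_dform (@antiholo n) w =
      1 *: partial_dform (@holo n) w + partial_dform (@antiholo n) w by rewrite scale1r.
  rewrite compform_lin scale1r compform_del compform_delbar cw.
  case: p hw {cw} => [|p] hw; first by rewrite add0r.
  by rewrite (compform_pq hw) ?partial_dform0 ?add0r//
    xpair_eqE negb_and neq_ltn ltnSn orbT.
split=> //; rewrite -e; apply/pqformsP.
rewrite -[delbar p q w]/(compform p q.+1 (dform w)); split.
  by apply: smooth_form_comp; apply: smooth_form_d.
by rewrite -[compform _ _ (dform w)]/(delbar p q w) e compform_delbar cw.
Qed.

Lemma deldelbar_pq p q w : pqforms X p q w ->
  deldelbar p q w = partial_dform (@holo n) (partial_dform (@antiholo n) w).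
Proof.
move=> hw; rewrite /deldelbar; have [-> h] := delbar_pq hw.
by have [-> _] := del_pq h.
Qed.

Lemma pqforms_kforms p q w : pqforms X p q w -> kforms X (p + q) w.
Proof.
move=> [sw hw]; split=> // i z S Sk; apply: hw; apply: contra Sk => /eqP e.
by rewrite -bidegree_card e.
Qed.

(** A set of size k has bidegree (p, k - p) for exactly one p <= k, so a single summand survives in
    each coefficient. *)
Lemma kforms_sum k w : kforms X k w -> w = \sum_(p < k.+1) compform p (k - p) w.
Proof.
move=> [sw hw]; apply: funext => i; apply: funext => z; apply/ffunP => S.
rewrite !fct_sumE sum_ffunE.
have E (p : 'I_k.+1) : compform p (k - p) w i z S =
    if bidegree S == (p : nat, k - p)%N then w i z S else 0.
  by rewrite /compform componentE.
rewrite (eq_bigr _ (fun p _ => E p)).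
have [Sk|Sk] := eqVneq #|S| k; last first.
  by rewrite hw// big1// => p _; case: ifP.
have b1 : ((bidegree S).1 < k.+1)%N by rewrite ltnS -Sk -bidegree_card leq_addr.
have bS : bidegree S == (nat_of_ord (Ordinal b1), (k - Ordinal b1)%N).
  have e : (k - (bidegree S).1)%N = (bidegree S).2 by rewrite -Sk -bidegree_card addKn.
  by apply/eqP; rewrite [LHS]surjective_pairing -e.
rewrite (bigD1 (Ordinal b1))// bS.
rewrite big1; first by rewrite [RHS]addr0.
move=> p pb; case: eqP => // e; case/eqP: pb; apply: val_inj => /=.
exact: esym (congr1 fst e).
Qed.
End GlobalOperators.

(** * Aeppli and De Rham cohomology *)

Section Cosets.
Context (K : pzRingType) (V : lmodType K) (Z B : submodule V).
Local Notation Q := (quotient_space Z B).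
Implicit Types (c d : Q).

Lemma coset_sub c u v : c u -> c v -> B (u - v).
Proof.
rewrite !repr_cosetE /= => hu hv.
have -> : u - v = (u - repr_coset c) - (v - repr_coset c) by rewrite opprB addrA subrK.
exact: submoduleB.
Qed.

Lemma coset_eq c d u v : c u -> d v -> B (u - v) -> c = d.
Proof.
rewrite !repr_cosetE /= => hu hv uv.
rewrite -(repr_cosetK c) -(repr_cosetK d); apply: coset_classE.
have -> : repr_coset c - repr_coset d =
    (u - v) - (u - repr_coset c) + (v - repr_coset d).
  have -> : (u - v) - (u - repr_coset c) = repr_coset c - v.
    by rewrite opprB addrC addrA subrK.
  by rewrite addrA subrK.
by apply: submoduleD => //; apply: submoduleB.
Qed.

Lemma coset_class_mem z (hz : Z z) : coset_class B hz z.
Proof. by rewrite /= subrr; exact: submodule0. Qed.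

Lemma coset_lin (a : K) c d u v : c u -> d v -> coset (a *: c + d) (a *: u + v).
Proof.
elim/cosetW: c => x hx; elim/cosetW: d => y hy hu hv.
have haxy := submoduleP a hx hy; have hax := submoduleZ a hx.
rewrite (_ : a *: _ + _ = coset_class B haxy); last first.
  by rewrite [a *: _](coset_scaleE B hx hax); exact: coset_addE.
rewrite /=; have -> : a *: u + v - (a *: x + y) = a *: (u - x) + (v - y).
  by rewrite scalerBr opprD addrACA.
exact: submoduleP.
Qed.

Lemma coset0 : coset (0 : Q) 0.
Proof. exact: coset_class_mem. Qed.

Lemma coset_sum (I : Type) (r : seq I) (c : I -> Q) (w : I -> V) :
  (forall i, c i (w i)) -> coset (\sum_(i <- r) c i) (\sum_(i <- r) w i).
Proof.
move=> cw; elim: r => [|i r IH]; first by rewrite !big_nil; exact: coset0.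
by rewrite !big_cons -[c i]scale1r -[w i]scale1r; apply: coset_lin.
Qed.

Lemma submodule_sum (I : Type) (r : seq I) (w : I -> V) :
  (forall i, B (w i)) -> B (\sum_(i <- r) w i).
Proof.
move=> hw; elim: r => [|i r IH]; first by rewrite big_nil; exact: submodule0.
by rewrite big_cons; apply: submoduleD.
Qed.
End Cosets.

(** * Exactness and the del-delbar property *)

Section Exactness.
Context (R : realType) (n : nat) (X : complex_manifold R n).
Local Notation F := (local_forms X).
(* [A] is del and [B] is delbar. *)
Local Notation A := (@partial_dform R n X (@holo n)).
Local Notation B := (@partial_dform R n X (@antiholo n)).
Implicit Types (u v w a : F).

Lemma compform0 p q : compform p q (0 : F) = 0.
Proof. by apply: funext => i; apply: funext => z; rewrite /compform linear0. Qed.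
Local Opaque partial_dform dform compform.

Lemma pq_loc p q w : pqforms X p q w -> loc_smooth w.
Proof. by move=> [sw _]; exact: smooth_form_loc. Qed.

Lemma del_form p q w : pqforms X p q w -> pqforms X p.+1 q (A w).
Proof. by move=> /del_pq[]. Qed.

Lemma delbar_form p q w : pqforms X p q w -> pqforms X p q.+1 (B w).
Proof. by move=> /delbar_pq[]. Qed.

Lemma partial_dformD P u v : loc_smooth u -> loc_smooth v ->
  partial_dform P (u + v) = partial_dform P u + partial_dform P v.
Proof. by move=> us vs; rewrite -[u]scale1r partial_dform_lin// !scale1r. Qed.

Lemma partial_dformN P u : loc_smooth u -> partial_dform P (- u) = - partial_dform P u.
Proof.
move=> us; have s0 : loc_smooth (0 : F) by exact: smooth_form_loc (smooth_form0 X).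
by rewrite -scaleN1r -[_ *: u]addr0 partial_dform_lin// partial_dform0 addr0 scaleN1r.
Qed.

Lemma loc_smoothN u : loc_smooth u -> loc_smooth (- u).
Proof.
move=> us i S; have oi := @open_chart_image R n X i.
apply: (smooth_ext oi _ (smoothZ (-1) oi (us i S))) => z _.
by rewrite mulN1r !fctE ffunE.
Qed.

Lemma partial_dformB P u v : loc_smooth u -> loc_smooth v ->
  partial_dform P (u - v) = partial_dform P u - partial_dform P v.
Proof. by move=> us vs; rewrite partial_dformD ?partial_dformN//; exact: loc_smoothN. Qed.

Lemma delbar_del w : loc_smooth w -> B (A w) = - A (B w).
Proof. by move=> ws; rewrite partial_dform_anticomm. Qed.

(** The two parts of d w have different types and hence vanish separately. *)
Lemma closed_pq p q w : pqforms X p q w -> dform w = 0 -> A w = 0 /\ B w = 0.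
Proof.
move=> hw; rewrite dform_split => e.
have hA := del_form hw; have hB := delbar_form hw.
have pq : (p, q.+1) != (p.+1, q) by rewrite xpair_eqE negb_and neq_ltn ltnSn.
have e1 : compform p.+1 q (1 *: A w + B w) = A w.
  by rewrite compform_lin ((pqformsP p.+1 q _).1 hA).2 (compform_pq hB pq) addr0 scale1r.
have A0 : A w = 0.
  by rewrite -e1 scale1r e compform0.
by split=> //; move: e; rewrite A0 add0r.
Qed.

Lemma closed_pqI w : A w = 0 -> B w = 0 -> dform w = 0.
Proof. by move=> A0 B0; rewrite dform_split A0 B0 addr0. Qed.

Lemma del_exactP p q x : del_exact X p q x -> pqforms X p q x /\ A x = 0.
Proof.
case: p => [->|p /= [u hu <-]].
  by split; [exact: submodule0 | exact: partial_dform0].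
have [-> h] := del_pq hu; split=> //.
exact: partial_dform_sq (pq_loc hu).
Qed.

Lemma delbar_exactP p q x : delbar_exact X p q x -> pqforms X p q x /\ B x = 0.
Proof.
case: q => [->|q /= [u hu <-]].
  by split; [exact: submodule0 | exact: partial_dform0].
have [-> h] := delbar_pq hu; split=> //.
exact: partial_dform_sq (pq_loc hu).
Qed.

Lemma del_exactI p q u : pqforms X p q u -> del_exact X p.+1 q (A u).
Proof. by move=> hu; exists u => //; have [] := del_pq hu. Qed.

Lemma delbar_exactI p q u : pqforms X p q u -> delbar_exact X p q.+1 (B u).
Proof. by move=> hu; exists u => //; have [] := delbar_pq hu. Qed.

(* Forms of type (p, q - 1); only 0 is one if q = 0. *)
Definition pq_pred p q a := if q is q'.+1 then pqforms X p q' a else a = 0.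

Lemma pq_pred_loc p q a : pq_pred p q a -> loc_smooth a.
Proof.
case: q => [->|q]; last exact: pq_loc.
exact: smooth_form_loc (smooth_form0 X).
Qed.

Lemma pq_pred_exact p q a : pq_pred p q a -> delbar_exact X p q (B a).
Proof. by case: q => [->|q ha]; [exact: partial_dform0 | exact: delbar_exactI]. Qed.

Section DelDelbar.
Hypothesis ddbar : deldelbar_manifold X.

Lemma del_solve p q u : pqforms X p q u -> B (A u) = 0 ->
  exists2 a, pq_pred p q a & A u = A (B a).
Proof.
move=> hu BA; have hA := del_form hu.
have A2 : A (A u) = 0 by exact: partial_dform_sq (pq_loc hu).
have T := ddbar hA (closed_pqI A2 BA).
(* The indices 0, 1, 2, 3 stand for d-, del-, delbar- and del-delbar-exactness. *)
have := (T 1%N 3%N).1 (del_exactI hu).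
(* For q = 0 the space of del-delbar-exact forms is 0, so del u = 0 and a = 0 will do. *)
case: q hu {hA T} => [|q] hu.
  move=> e; have {}e : A u = 0 := e.
  exists 0; first by [].
  by rewrite e [B 0]partial_dform0 [A 0]partial_dform0.
by case=> a ha <-; exists a => //; rewrite (deldelbar_pq ha).
Qed.

(** Only del b, of the same type as u, enters the correction of u; hence b itself is recorded merely
    as smooth in the charts. *)
Lemma delbar_solve p q u : pqforms X p q u -> A (B u) = 0 ->
  exists2 b, del_exact X p q (A b) & loc_smooth b /\ B u = A (B b).
Proof.
move=> hu AB; have hB := delbar_form hu.
have B2 : B (B u) = 0 by exact: partial_dform_sq (pq_loc hu).
have T := ddbar hB (closed_pqI AB B2).
have := (T 2%N 3%N).1 (delbar_exactI hu).
case: p hu {hB T} => [|p] hu.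
  move=> e; have {}e : B u = 0 := e.
  exists 0; first by rewrite partial_dform0; exact: submodule0.
  split; first exact: smooth_form_loc (smooth_form0 X).
  by rewrite e [B 0]partial_dform0 [A 0]partial_dform0.
case=> a ha <-; exists a; first exact: del_exactI.
by split; [exact: pq_loc ha | rewrite (deldelbar_pq ha)].
Qed.

Lemma aeppli_closed_rep p q u : pqforms X p q u -> deldelbar p q u = 0 ->
  exists w, [/\ pqforms X p q w, dform w = 0 &
    sum_submodule (del_exact X p q) (delbar_exact X p q) (w - u)].
Proof.
move=> hu; rewrite (deldelbar_pq hu) => AB; have us := pq_loc hu.
have BA : B (A u) = 0 by rewrite (delbar_del us) AB oppr0.
have [a ha ea] := del_solve hu BA.
have [b hx [bs eb]] := delbar_solve hu AB.
have as_ := pq_pred_loc ha; have hBa := pq_pred_exact ha.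
have [hA _] := del_exactP hx; have [hB _] := delbar_exactP hBa.
(* The opposite signs come from anticommutation: del leaves del u - del delbar a, while delbar
   leaves delbar u + delbar del b = delbar u - del delbar b. *)
exists (u + (A b - B a)); split.
- exact: submoduleD hu (submoduleB hA hB).
- have As := pq_loc hA; have Bs := pq_loc hB.
  have sAB : loc_smooth (A b - B a) by exact: pq_loc (submoduleB hA hB).
  apply: closed_pqI; rewrite (partial_dformD _ us sAB) (partial_dformB _ As Bs).
    by rewrite (partial_dform_sq (@holo n) bs) sub0r ea; exact: subrr.
  by rewrite (partial_dform_sq (@antiholo n) as_) subr0 (delbar_del bs) eb; exact: subrr.
- exists (A b), (- B a); split; [exact: hx | exact: submoduleN hBa |].
  by rewrite addrC addKr.
Qed.

Lemma aeppli_zero_d_exact p q w : pqforms X p q w -> dform w = 0 ->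
  sum_submodule (del_exact X p q) (delbar_exact X p q) w -> d_exact X (p + q) w.
Proof.
move=> hw dw [x [y [hx hy e]]]; have [A0 B0] := closed_pq hw dw.
have [hx' Ax] := del_exactP hx; have [hy' By] := delbar_exactP hy.
have xs := pq_loc hx'; have ys := pq_loc hy'.
(* As delbar y = 0, the equation delbar w = 0 leaves delbar x = 0; the next line is symmetric. *)
have Bx : B x = 0 by move: B0; rewrite e (partial_dformD _ xs ys) By addr0.
have Ay : A y = 0 by move: A0; rewrite e (partial_dformD _ xs ys) Ax add0r.
rewrite e; apply: submoduleD.
  exact: ((ddbar hx' (closed_pqI Ax Bx)) 1%N 0%N).1 hx.
exact: ((ddbar hy' (closed_pqI Ay By)) 2%N 0%N).1 hy.
Qed.

Lemma d_exact_aeppli_zero p q w : pqforms X p q w -> dform w = 0 ->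
  d_exact X (p + q) w -> sum_submodule (del_exact X p q) (delbar_exact X p q) w.
Proof.
move=> hw dw h; exists w, 0; split; [|exact: submodule0|by rewrite addr0].
exact: ((ddbar hw dw) 0%N 1%N).1 h.
Qed.
End DelDelbar.
End Exactness.

(** * The maps from Aeppli to De Rham cohomology *)

Section Comparison.
Context (R : realType) (n : nat) (X : complex_manifold R n).
Local Notation F := (local_forms X).
Local Notation C := (R[i]).
Local Notation A := (@partial_dform R n X (@holo n)).
Local Notation B := (@partial_dform R n X (@antiholo n)).
Implicit Types (u v w a : F).
Local Opaque partial_dform dform compform.
Hypothesis ddbar : deldelbar_manifold X.

Local Notation pq_exact p q := (sum_submodule (del_exact X p q) (delbar_exact X p q)).

Lemma closed_representative_ex p q (c : aeppli X p q) :
  exists w, closed_representative c w.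
Proof.
have [hz dz] := repr_cosetZ c.
have [w [hw dw ew]] := aeppli_closed_rep ddbar hz dz.
by exists w; split=> //; rewrite repr_cosetE.
Qed.

Definition closed_rep p q (c : aeppli X p q) : F :=
  projT1 (cid (closed_representative_ex c)).

Lemma closed_repP p q (c : aeppli X p q) : closed_representative c (closed_rep c).
Proof. by rewrite /closed_rep; case: cid. Qed.

Lemma dform_sub0 k u v : kforms X k u -> kforms X k v ->
  dform u = 0 -> dform v = 0 -> dform (u - v) = 0.
Proof.
move=> hu hv du dv; have := d_linear (-1) hv hu.
by rewrite scaleN1r addrC du dv scaler0 addr0.
Qed.

Lemma closed_representative_lin p q (a : C) (c d : aeppli X p q) u v :
  closed_representative c u -> closed_representative d v ->
  closed_representative (a *: c + d) (a *: u + v).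
Proof.
move=> [cu hu du] [dv hv dv0]; split; [exact: coset_lin|exact: submoduleP|].
by rewrite (d_linear _ (pqforms_kforms hu) (pqforms_kforms hv)) du dv0 scaler0 addr0.
Qed.

Lemma closed_representative_exact p q (c : aeppli X p q) u v :
  closed_representative c u -> closed_representative c v -> d_exact X (p + q) (u - v).
Proof.
move=> hu hv; have [cu pu du] := hu; have [cv pv dv] := hv.
apply: (aeppli_zero_d_exact ddbar); last exact: coset_sub cu cv.
  exact: submoduleB pu pv.
exact: dform_sub0 (pqforms_kforms pu) (pqforms_kforms pv) du dv.
Qed.

Section Degree.
Context (p q k : nat) (pqk : (p + q)%N = k).

Lemma closed_rep_cocycle (c : aeppli X p q) :
  ker_submodule (@d_linear R n X k) (closed_rep c).
Proof.
have [_ hw dw] := closed_repP c; split=> //.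
by rewrite -pqk; exact: pqforms_kforms.
Qed.

(** The degree is a variable k with p + q = k, so that the same map serves in degree p + q and for
    the summands of type (p, k - p). *)
Definition aeppli_deRham (c : aeppli X p q) : deRham X k :=
  coset_class (d_exact X k) (closed_rep_cocycle c).

Lemma aeppli_deRham_rep (c : aeppli X p q) w :
  closed_representative c w -> aeppli_deRham c w.
Proof.
move=> hw; rewrite /aeppli_deRham /=; rewrite -pqk.
exact: closed_representative_exact hw (closed_repP c).
Qed.

(** The chosen representatives need not depend linearly on the class, but their combination is
    another closed representative of a *: c + d, and the De Rham class does not depend on the
    choice. *)
Lemma aeppli_deRham_linear : linear aeppli_deRham.
Proof.
move=> a c d; have h := closed_representative_lin a (closed_repP c) (closed_repP d).
apply: (coset_eq (aeppli_deRham_rep h)).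
  exact: coset_lin (aeppli_deRham_rep (closed_repP c))
    (aeppli_deRham_rep (closed_repP d)).
by rewrite subrr; exact: submodule0.
Qed.
HB.instance Definition _ := GRing.isLinear.Build C (aeppli X p q) (deRham X k) _
  aeppli_deRham aeppli_deRham_linear.

Lemma aeppli_deRham_inj : injective aeppli_deRham.
Proof.
move=> c d e; have hc := closed_repP c; have hd := closed_repP d.
have [cc pc dc] := hc; have [dd pd dd0] := hd.
have ex : d_exact X k (closed_rep c - closed_rep d).
  by apply: coset_sub (aeppli_deRham_rep hc) _; rewrite e; exact: aeppli_deRham_rep.
apply: (coset_eq cc dd); apply: (d_exact_aeppli_zero ddbar).
- exact: submoduleB pc pd.
- exact: dform_sub0 (pqforms_kforms pc) (pqforms_kforms pd) dc dd0.
- by rewrite pqk.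
Qed.
End Degree.

Section Sum.
Context (k : nat).

Lemma ord_subnKC (p : 'I_k.+1) : (p + (k - p))%N = k.
Proof. by rewrite subnKC// -ltnS. Qed.

Definition aeppli_sum_deRham (c : aeppli_sum X k) : deRham X k :=
  \sum_(p < k.+1) aeppli_deRham (ord_subnKC p) (c p).

Lemma aeppli_sum_deRham_linear : linear aeppli_sum_deRham.
Proof.
move=> a c d; rewrite /aeppli_sum_deRham scaler_sumr -big_split; apply: eq_bigr => p _ /=.
exact: aeppli_deRham_linear.
Qed.
HB.instance Definition _ := GRing.isLinear.Build C (aeppli_sum X k) (deRham X k) _
  aeppli_sum_deRham aeppli_sum_deRham_linear.

Lemma aeppli_sum_deRham_rep (c : aeppli_sum X k) (w : 'I_k.+1 -> F) :
  (forall p : 'I_k.+1, closed_representative (c p) (w p)) ->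
  aeppli_sum_deRham c (\sum_(p < k.+1) w p).
Proof. by move=> hw; apply: coset_sum => p; apply: aeppli_deRham_rep. Qed.

(** The component of type (p, q) of d eta is del of one component of eta plus delbar of another; a
    term whose type would have a negative index is 0. *)
Lemma d_exact_component p q w : (p + q)%N = k -> d_exact X k w ->
  pq_exact p q (compform p q w).
Proof.
case: k => [|k'] pqk.
  move=> e; have -> : w = 0 := e.
  by rewrite compform0; exact: submodule0.
case=> eta heta <-.
rewrite dform_split -[A eta]scale1r compform_lin scale1r compform_del compform_delbar.
have [seta _] := heta.
have pqc p' q' : pqforms X p' q' (compform p' q' eta) by exact: compform_pqforms.
exists (if p is p'.+1 then A (compform p' q eta) else 0),
  (if q is q'.+1 then B (compform p q' eta) else 0); split=> //.
  by case: p {pqk} => [|p]; [exact: submodule0 | exact: del_exactI].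
by case: q {pqk} => [|q]; [exact: submodule0 | exact: delbar_exactI].
Qed.

Lemma compform_sum p q (w : 'I_k.+1 -> F) :
  compform p q (\sum_(r < k.+1) w r) = \sum_(r < k.+1) compform p q (w r).
Proof.
have D u v : compform p q (u + v) = compform p q u + compform p q v.
  by rewrite -[u]scale1r compform_lin !scale1r.
exact: (big_morph (compform p q) D (compform0 _ _ _)).
Qed.

Lemma aeppli_sum_deRham_inj : injective aeppli_sum_deRham.
Proof.
apply: raddf_inj => c c0; apply: direct_sumP => p.
have hc r := closed_repP (c r).
have ex : d_exact X k (\sum_(r < k.+1) closed_rep (c r)).
  have := coset_sub (aeppli_sum_deRham_rep hc) _; rewrite c0 => /(_ _ (coset0 _ _)).
  by rewrite subr0.
have [cp pp _] := hc p.
apply: (coset_eq cp (coset0 _ _)); rewrite subr0.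
have := d_exact_component (ord_subnKC p) ex; rewrite compform_sum (bigD1 p)//= big1.
  by rewrite addr0 ((pqformsP _ _ _).1 pp).2.
move=> r rp; have [_ pr _] := hc r.
by rewrite (compform_pq pr)// xpair_eqE negb_and (inj_eq val_inj) rp.
Qed.

Lemma d_exactI j w : kforms X j w -> j.+1 = k -> d_exact X k (dform w).
Proof. by move=> hw <-; exists w. Qed.

(** The equations del u_p = del delbar a_p are solved separately for each p. The solutions fit
    together because d u = 0 links delbar u_(p+1) to del u_p: the form a_p that corrects del u_p
    also corrects delbar u_(p+1). *)
Lemma aeppli_sum_deRham_surj (y : deRham X k) : exists c, aeppli_sum_deRham c = y.
Proof.
elim/cosetW: y => u hu; have [ku du] := hu; have [su _] := ku.
pose u_ p := compform p (k - p) u.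
have pu p : pqforms X p (k - p) (u_ p) by exact: compform_pqforms.
have cd p q : compform p q (A u) + compform p q (B u) = 0.
  rewrite -[compform p q (A u)]scale1r -compform_lin scale1r -dform_split du.
  exact: compform0.
(* The component of type (p + 1, k - p) of d u = 0. The two extreme types, with one term each, give
   [dk] and [d0]. *)
have dstep p : (p < k)%N -> A (u_ p) = - B (u_ p.+1).
  move=> pk; apply/eqP; rewrite -addr_eq0; apply/eqP.
  have := cd p.+1 (k - p)%N; rewrite compform_del compform_delbar.
  by rewrite /u_ -(subnSK pk).
have dk : A (u_ k) = 0.
  by have := cd k.+1 0%N; rewrite compform_del compform_delbar addr0 /u_ subnn.
have d0 : B (u_ 0%N) = 0.
  by have := cd 0%N k.+1; rewrite compform_del compform_delbar add0r /u_ subn0.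
have BA p : (p <= k)%N -> B (A (u_ p)) = 0.
  rewrite leq_eqVlt => /predU1P[->|pk]; first by rewrite dk partial_dform0.
  rewrite (dstep _ pk); have us := pq_loc (pu p.+1).
  by rewrite (partial_dformN _ (partial_dform_loc _ us)) (partial_dform_sq _ us) oppr0.
have /choice[a aP] : forall p, exists a, (p <= k)%N ->
    pq_pred p (k - p) a /\ A (u_ p) = A (B a).
  move=> p; have [pk|pk] := leqP p k; last by exists 0.
  have [a ha ea] := del_solve ddbar (pu p) (BA _ pk).
  by exists a => _; split; [exact: ha | exact: ea].
(* Here a_p has type (p, k - p - 1), so del a_(p-1) contributes to type (p, k - p). *)
pose v p := if p is p'.+1 then A (a p') else 0.
have pv p : (p <= k)%N -> pqforms X p (k - p) (v p).
  case: p => [|p] pk; first exact: submodule0.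
  have [ha _] := aP p (ltnW pk); apply: del_form.
  by move: ha; rewrite -(subnSK pk).
have pBa p : (p <= k)%N -> pqforms X p (k - p) (B (a p)).
  by move=> pk; have [/pq_pred_exact/delbar_exactP[]] := aP p pk.
(* The component of type (p, k - p) of u minus the sum of the d a_p. *)
pose w p := u_ p - (B (a p) + v p).
have pw p : (p <= k)%N -> pqforms X p (k - p) (w p).
  by move=> pk; exact: submoduleB (pu p) (submoduleD (pBa _ pk) (pv _ pk)).
have Av p : (p <= k)%N -> A (v p) = 0.
  case: p => [|p] pk; first exact: partial_dform0.
  by have [ha _] := aP p (ltnW pk); exact: partial_dform_sq (pq_pred_loc ha).
have dw p : (p <= k)%N -> dform (w p) = 0.
  move=> pk; have us := pq_loc (pu p); have vs := pq_loc (pv p pk).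
  have bs := pq_loc (pBa p pk); have [ha ea] := aP p pk.
  have bvs := pq_loc (submoduleD (pBa _ pk) (pv _ pk)).
  apply: closed_pqI; rewrite (partial_dformB _ us bvs) (partial_dformD _ bs vs).
    by rewrite (Av _ pk) addr0 ea; exact: subrr.
  rewrite (partial_dform_sq _ (pq_pred_loc ha)) add0r.
  case: p pk {us vs bs ha ea bvs} => [|p] pk.
    by rewrite d0 [B (v _)]partial_dform0 subr0.
  have [ha ea] := aP p (ltnW pk).
  (* delbar del a_p = - del delbar a_p = - del u_p, which equals delbar u_(p+1). *)
  rewrite [B (v _)](delbar_del (pq_pred_loc ha)) -ea (dstep _ pk) opprK.
  exact: subrr.
have hZ (p : 'I_k.+1) : ker_submodule (@deldelbar_linear R n X p (k - p)) (w p).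
  have pk : (p <= k)%N by rewrite -ltnS.
  split; first exact: pw.
  by rewrite (deldelbar_pq (pw _ pk)) (closed_pq (pw _ pk) (dw _ pk)).2 partial_dform0.
pose c : aeppli_sum X k := fun p => coset_class (pq_exact p (k - p)) (hZ p).
have hc (p : 'I_k.+1) : closed_representative (c p) (w p).
  have pk : (p <= k)%N by rewrite -ltnS.
  split; [exact: coset_class_mem | exact: pw | exact: dw].
exists c; apply: (coset_eq (aeppli_sum_deRham_rep hc) (coset_class_mem _ hu)).
(* Shifting the index from [v] to the a_p adds a last term del a_k; it vanishes because a_k would
   have type (k, -1) and is 0. *)
have ak : A (a k) = 0.
  by have [+ _] := aP k (leqnn k); rewrite subnn => ->; exact: partial_dform0.
have sv : \sum_(p < k.+1) v p = \sum_(p < k.+1) A (a p).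
  by rewrite big_ord_recl add0r [RHS]big_ord_recr /= ak addr0.
have -> : \sum_(p < k.+1) w p - u = - \sum_(p < k.+1) dform (a p).
  rewrite /w sumrB -(kforms_sum ku) addrC addKr; congr (- _).
  rewrite big_split /= sv -big_split /=; apply: eq_bigr => p _.
  by rewrite dform_split addrC.
apply: submoduleN; apply: submodule_sum => p.
have pk : (p <= k)%N by rewrite -ltnS.
(* Either p = k and a_p = 0, or a_p has degree k - 1; in both cases d a_p is exact in degree k. *)
have [+ _] := aP p pk; case e : (k - p)%N => [|q] ha.
  rewrite [a p]ha dform_split [A 0]partial_dform0 [B 0]partial_dform0 addr0.
  exact: submodule0.
by apply: (d_exactI (pqforms_kforms ha)); rewrite -addnS -e subnKC.
Qed.
End Sum.
End Comparison.

(** * Conjugation of Aeppli classes *)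

Section ConjugateClasses.
Context (R : realType) (n : nat) (X : complex_manifold R n).
Local Notation F := (local_forms X).
Local Notation C := (R[i]).
Local Notation A := (@partial_dform R n X (@holo n)).
Local Notation B := (@partial_dform R n X (@antiholo n)).
Local Notation conj := (@conj_form R n X).
Implicit Types (u v w a : F).
Local Opaque wirt ext_wirt conj_ext component.

Lemma conj_formK : involutive conj.
Proof.
by move=> w; apply: funext => i; apply: funext => z; rewrite /conj_form conj_extK.
Qed.

Lemma conj_formD u v : conj (u + v) = conj u + conj v.
Proof.
by apply: funext => i; apply: funext => z; exact: conj_extD.
Qed.

Lemma conj_form0 : conj 0 = 0.
Proof. by apply: funext => i; apply: funext => z; exact: conj_ext0. Qed.

Lemma conj_formB u v : conj (u - v) = conj u - conj v.
Proof. by rewrite -[in RHS](subrK v u) [in RHS]conj_formD addrK. Qed.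

Lemma smooth_form_conj w : smooth_form w -> smooth_form (conj w).
Proof.
move=> sw; have [w0 ws wc] := sw; split.
- by move=> i z iz; rewrite /conj_form w0// conj_ext0.
- by move=> i; apply: ext_smooth_conj; [exact: open_chart_image | exact: ws].
- move=> i j x ix jx; have Wx : overlap i j (chart i x) by exists x.
  rewrite /conj_form (wc i j x ix jx).

  exact: (conj_pullback (w j) (@open_overlap _ _ X i j) Wx
    (holomorphic_map_smooth (@open_overlap _ _ X i j)
      (@transition_holomorphic _ _ X i j))).
Qed.

Lemma pqforms_conj p q w : pqforms X p q w -> pqforms X q p (conj w).
Proof.
move=> /pqformsP[sw hw]; apply/pqformsP; split; first exact: smooth_form_conj.
rewrite -[in RHS]hw; apply: funext => i; apply: funext => z.
exact: component_conj.
Qed.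

Lemma partial_dform_conj P w : loc_smooth w ->
  partial_dform P (conj w) = conj (partial_dform (fun s => P (cswap s)) w).
Proof.
move=> ws; apply: funext => i; apply: funext => z; rewrite /conj_form /partial_dform.
case: ifPn => [|_]; last by rewrite conj_ext0.
rewrite inE => iz; apply: partial_d_conj.
exact: ext_smooth_cderivable (ws i) iz.
Qed.

Local Opaque partial_dform conj_form.

Lemma conj_del w : loc_smooth w -> conj (A w) = B (conj w).
Proof.
move=> ws; rewrite (partial_dform_conj _ ws).
rewrite (_ : (fun s => antiholo (cswap s)) = @holo n)//.
by apply: funext => s; rewrite /antiholo holo_cswap negbK.
Qed.

Lemma conj_delbar w : loc_smooth w -> conj (B w) = A (conj w).
Proof.
move=> ws; rewrite (partial_dform_conj _ ws).
rewrite (_ : (fun s => holo (cswap s)) = @antiholo n)//.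
by apply: funext => s; rewrite /antiholo holo_cswap.
Qed.

Lemma conj_del_exact p q x : del_exact X p q x -> delbar_exact X q p (conj x).
Proof.
case: p => [|p]; first by move=> h; have -> : x = 0 := h; rewrite conj_form0.
case=> u hu <-; rewrite (del_pq hu).1 (conj_del (pq_loc hu)).
exact: delbar_exactI (pqforms_conj hu).
Qed.

Lemma conj_delbar_exact p q x : delbar_exact X p q x -> del_exact X q p (conj x).
Proof.
case: q => [|q]; first by move=> h; have -> : x = 0 := h; rewrite conj_form0.
case=> u hu <-; rewrite (delbar_pq hu).1 (conj_delbar (pq_loc hu)).
exact: del_exactI (pqforms_conj hu).
Qed.

(** Conjugation exchanges del and delbar, so it turns del delbar w into delbar del of the conjugate,
    which is its del delbar up to sign. *)
Lemma conj_ker p q w : ker_submodule (@deldelbar_linear R n X p q) w ->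
  ker_submodule (@deldelbar_linear R n X q p) (conj w).
Proof.
move=> [hw]; rewrite (deldelbar_pq hw) => AB.
have ws := pq_loc hw; split; first exact: pqforms_conj.
rewrite (deldelbar_pq (pqforms_conj hw)) -(conj_del ws).
rewrite -(conj_delbar (partial_dform_loc _ ws)) (delbar_del ws) AB oppr0.
exact: conj_form0.
Qed.

Lemma conj_aeppli_exact p q x :
  sum_submodule (del_exact X p q) (delbar_exact X p q) x ->
  sum_submodule (del_exact X q p) (delbar_exact X q p) (conj x).
Proof.
move=> [u [v [hu hv ->]]]; exists (conj v), (conj u); split.
- exact: conj_delbar_exact.
- exact: conj_del_exact.
- by rewrite conj_formD; exact: addrC.
Qed.

Lemma conj_aeppli_class p q (c : aeppli X p q) :
  aeppli_classes X q p (@conj_class R n X (coset c)).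
Proof.
elim/cosetW: c => z hz.
exists (coset_class _ (conj_ker hz)) => //; apply/seteqP; split=> v /=.
  move=> hv; exists (conj v); last exact: conj_formK.
  by rewrite /= -(conj_formK z) -conj_formB; exact: conj_aeppli_exact.
by move=> [u hu <-]; rewrite -conj_formB; exact: conj_aeppli_exact.
Qed.

(** Conjugation maps classes of type (q, p) to classes of type (p, q) for all p and q; being an
    involution, it is then onto. *)
Lemma aeppli_classes_conj p q :
  aeppli_classes X p q = (@conj_class R n X) @` aeppli_classes X q p.
Proof.
apply/seteqP; split=> [_ [c _ <-]|_ [_ [c _ <-] <-]]; last exact: conj_aeppli_class.
exists (@conj_class R n X (coset c)); first exact: conj_aeppli_class.
apply/seteqP; split=> v; first by move=> [_ [u cu <-] <-]; rewrite conj_formK.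
by move=> cv; exists (conj v); [exists v | exact: conj_formK].
Qed.
End ConjugateClasses.

Theorem theorem3p2 (R : realType) (n : nat) (X : complex_manifold R n)
    (X_compact : compact [set: X]) :
  (deldelbar_manifold X ->
    [/\ forall (p q : nat) (c : aeppli X p q), exists w, closed_representative c w,
        forall p q : nat, (p <= n)%N -> (q <= n)%N ->
          exists T : {linear aeppli X p q -> deRham X (p + q)},
            injective T /\
            forall (c : aeppli X p q) w, closed_representative c w -> T c w
      & forall k : nat, (k <= 2 * n)%N ->
          exists F : {linear aeppli_sum X k -> deRham X k},
            bijective F /\
            forall (c : aeppli_sum X k) (w : 'I_k.+1 -> local_forms X),
              (forall p : 'I_k.+1, closed_representative (c p) (w p)) ->
              F c (\sum_(p < k.+1) w p)]) /\
  forall p q : nat,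
    aeppli_classes X p q = (@conj_class _ _ X) @` aeppli_classes X q p.
Proof.
split; last exact: aeppli_classes_conj.
move=> ddbar; split=> [p q c|p q _ _|k _].
- exact: closed_representative_ex.
- exists (aeppli_deRham ddbar (erefl (p + q)%N)); split.
    exact: aeppli_deRham_inj.
  exact: aeppli_deRham_rep.
- exists (@aeppli_sum_deRham _ _ _ ddbar k); split.
    (* [bijective] asks for an inverse function: G chooses preimages, and injectivity makes it a
       left inverse as well. *)
    have /choice[G FG] := @aeppli_sum_deRham_surj _ _ _ ddbar k.
    by exists G => // c; apply: (@aeppli_sum_deRham_inj _ _ _ ddbar); rewrite FG.
  exact: aeppli_sum_deRham_rep.
Qed.
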